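(* Let $n_A,n_B,n_C$ be positive integers, $n=n_A+n_B+n_C$, $d=2^n$, $d_A=2^{n_A}$, $d_B=2^{n_B}$. Let $|\Psi\rangle_{ABC}$ be a Haar random pure state on the $n$-qubit system $ABC$ and $\rho_{AB}=\operatorname{Tr}_C|\Psi\rangle\langle\Psi|$. Let $m\in\mathbb{N}$ and $0<h\le1$, and suppose $\delta:=h^2-2^{-m}>0$. Then for every constant $0<c<1$, $$\log\Pr\Big[E_{D,h}^{[\mathrm{LO}]}(A:B)\ge m\Big]\le -c\,\delta^2 d+O\Big(2^{2m}(d_A^2+d_B^2)\log\tfrac1\delta\Big).$$
   Context: $A,B,C$ are systems of $n_A,n_B,n_C$ qubits. $|\mathrm{EPR}\rangle=\frac{1}{\sqrt2}(|00\rangle+|11\rangle)$. For $m$-qubit systems $R_A,R_B$, $\Pi^{[\mathrm{EPR}]}_{R_AR_B}$ is the projector onto $m$ EPR pairs, each pairing one qubit of $R_A$ with one of $R_B$. The one-shot LO-distillable entanglement is $E_{D,h}^{[\mathrm{LO}]}(A:B)=\sup\{m\in\mathbb{N}:\exists\,\Lambda=\Phi_A\otimes\Phi_B,\ \operatorname{Tr}(\Lambda(\rho_{AB})\Pi^{[\mathrm{EPR}]}_{R_AR_B})\ge h^2\}$, where $\Phi_A$ is any quantum channel (CPTP map) from states on $A$ to states on an $m$-qubit system $R_A$, and similarly $\Phi_B$ from $B$ to an $m$-qubit system $R_B$. Haar random means uniformly distributed on unit vectors of $\mathbb{C}^d$. $\log$ is the logarithm and the $O(\cdot)$ term hides a multiplicative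 constant depending only on $c$. *)

(* Defs.v *)
From HB Require Import structures.
From mathcomp Require Import all_boot all_order all_algebra.
From mathcomp Require Import all_classical all_reals all_analysis.
From mathcomp Require Import complex.
Set Implicit Arguments.
Unset Strict Implicit.
Unset Printing Implicit Defensive.
Import Order.TTheory GRing.Theory Num.Theory.
Local Open Scope ring_scope.
Local Open Scope classical_set_scope.

Section QInfo.
Variable R : realType.
Local Notation C := R[i].

Definition op (I : finType) := I -> I -> C.

Definition trace (I : finType) (X : op I) : C := \sum_(i : I) X i i.

Definition opmul (I : finType) (X Y : op I) : op I :=
  fun i j => \sum_(k : I) X i k * Y k j.

(* positive semidefinite (over C this includes hermiticity) *)
Definition psd (I : finType) (X : op I) : Prop :=
  forall v : I -> C, 0 <= \sum_(i : I) \sum_(j : I) (v i)^* * X i j * v j.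

Definition op_linear (I J : finType) (Phi : op I -> op J) : Prop :=
  forall (a : C) (X Y : op I) (i j : J),
    Phi (fun k l => a * X k l + Y k l) i j = a * Phi X i j + Phi Y i j.

Definition ampl (k : nat) (I J : finType) (Phi : op I -> op J) :
  op ('I_k * I)%type -> op ('I_k * J)%type :=
  fun X p q => Phi (fun i i' => X (p.1, i) (q.1, i')) p.2 q.2.

Definition completely_positive (I J : finType) (Phi : op I -> op J) : Prop :=
  forall (k : nat) (X : op ('I_k * I)%type), psd X -> psd (ampl Phi X).

Definition trace_preserving (I J : finType) (Phi : op I -> op J) : Prop :=
  forall X : op I, trace (Phi X) = trace X.

Definition channel (I J : finType) (Phi : op I -> op J) : Prop :=
  [/\ op_linear Phi, completely_positive Phi & trace_preserving Phi].

(* computational basis of an n-qubit system: bit strings of length n *)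
Definition qubits (n : nat) : finType := {ffun 'I_n -> bool}.

Definition rhoAB (nA nB nC : nat)
  (psi : (qubits nA * qubits nB * qubits nC)%type -> C) :
  op (qubits nA * qubits nB)%type :=
  fun p q => \sum_(c : qubits nC) psi (p.1, p.2, c) * (psi (q.1, q.2, c))^*.

Definition LO_apply (nA nB m : nat)
  (PhiA : op (qubits nA) -> op (qubits m))
  (PhiB : op (qubits nB) -> op (qubits m))
  (rho : op (qubits nA * qubits nB)%type) : op (qubits m * qubits m)%type :=
  fun p q => PhiA (fun a a' => PhiB (fun b b' => rho (a, b) (a', b')) p.2 q.2) p.1 q.1.

(* |EPR>^{(x) m}, the k-th qubit of R_A paired with the k-th qubit of R_B;
   |EPR> = (|00> + |11>)/sqrt 2 *)
Definition EPRm (m : nat) : (qubits m * qubits m)%type -> C :=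
  fun p => \prod_(k < m) (((p.1 k == p.2 k)%:R : C) / real_complex R (Num.sqrt (2 : R))).

Definition PiEPR (m : nat) : op (qubits m * qubits m)%type :=
  fun p q => EPRm p * (EPRm q)^*.

Definition LO_achievable (nA nB : nat) (rho : op (qubits nA * qubits nB)%type)
  (h : R) (m : nat) : Prop :=
  exists (PhiA : op (qubits nA) -> op (qubits m))
         (PhiB : op (qubits nB) -> op (qubits m)),
    [/\ channel PhiA, channel PhiB &
        real_complex R (h ^+ 2) <= trace (opmul (LO_apply PhiA PhiB rho) (@PiEPR m))].

(* E_{D,h}^{[LO]}(A:B) >= m, i.e. sup {m' | LO_achievable m'} >= m
   (for a set of naturals, the sup is >= m iff some element is >= m) *)
Definition LO_distillable_ge (nA nB : nat) (rho : op (qubits nA * qubits nB)%type)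
  (h : R) (m : nat) : Prop :=
  exists m' : nat, (m <= m')%N /\ LO_achievable rho h m'.

(* Borel sigma-algebra on C^I: generated by the real and imaginary parts
   of the coordinates (= Borel sets of R^(2|I|)) *)
Definition coord_gen (I : finType) : set (set (I -> C)) :=
  [set S | exists (i : I) (B : set R), measurable B /\
     (S = [set v | B (complex.Re (v i))] \/ S = [set v | B (complex.Im (v i))])].

Definition borelC (I : finType) (E : set (I -> C)) : Prop :=
  smallest (sigma_algebra setT) (@coord_gen I) E.

Definition unitary (I : finType) (U : op I) : Prop :=
  forall i j : I, \sum_(k : I) (U k i)^* * U k j = (i == j)%:R.

Definition op_apply (I : finType) (U : op I) (v : I -> C) : I -> C :=
  fun i => \sum_(j : I) U i j * v j.

Definition haar_random (dsp : measure_display) (Omega : measurableType dsp)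
  (P : probability Omega R) (I : finType) (psi : Omega -> I -> C) : Prop :=
  [/\ forall w, \sum_(i : I) `|psi w i| ^+ 2 = 1,
      forall E, borelC E -> measurable (psi @^-1` E) &
      forall (U : op I) (E : set (I -> C)), unitary U -> borelC E ->
        P (psi @^-1` E) = P ((fun w => op_apply U (psi w)) @^-1` E)].

End QInfo.

(* Main.v *)
Require Import Defs.
From HB Require Import structures.
From mathcomp Require Import all_boot all_order all_algebra.
From mathcomp Require Import all_classical all_reals all_analysis measurable_realfun.
From mathcomp Require Import perm complex spectral.
From mathcomp Require Import ring lra zify.
Set Implicit Arguments.
Unset Strict Implicit.
Unset Printing Implicit Defensive.
Import Order.TTheory GRing.Theory Num.Theory numFieldNormedType.Exports.
Local Open Scope ring_scope.
Local Open Scope classical_set_scope.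

(* For a fixed pair of channels the EPR fidelity is a quadratic form
   [<psi|M|psi>] with [0 <= M <= 1] and [tr M <= 2^-m d].  Unitary invariance of
   [psi] under rotations of coordinate planes determines the moments of
   [X = sum_i l_i |psi_i|^2]: [E X^k] is the complete homogeneous symmetric
   polynomial [h_k] at the [l_i] divided by its value at [(1, .., 1)], so that
   [E X^k <= prod_{a < k} (tr M + a) / (d + a)]; with [k ~ 2 delta d] Markov's
   inequality gives [exp (- delta^2 d)].

   Instead of an epsilon-net: the [k]-th power of the fidelity is a form of
   bidegree [(k, k)] in the Choi matrices of the two channels, hence by
   interpolation at Fekete points of this finite-dimensional space its supremum
   is at most twice the sum of its values at [D] pairs of channels, where
   [D <= x^(-2k) (1 - x)^(-N)] for all [0 < x < 1], with
   [N = 2^(2m) (dA^2 + dB^2)].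

   When [delta] is close to 1 the factor [log (1 / delta)] is too small to absorb
   [D]; then one discards all but a constant number of the EPR pairs. *)

(** * Rising factorials and symmetric polynomials *)

(** [haar_random] provides invariance under unitaries and no density, so all moments are extracted
    from that invariance; the tangent of the angle as parameter turns it into identities between
    polynomials.

    The gain from Markov is about [exp (- delta k / 2)]. With [x = exp (- eta delta)] the factor
    [x^(-2k)] of [D] is at most [exp (4 eta delta^2 d)], a small fraction of that gain, and
    [(1 - x)^(-N)] is at most [(2 / (eta delta))^N], which is the error term. A small [eta]
    therefore reaches every [c < 1].

    For [delta] near 1, [h <= 1] gives [1 - delta >= 2^-m], hence [2^(2m) log (1 / delta) >= 2^m].
    So the error term always dominates a constant multiple of [dA^2 + dB^2], and that is all the
    bound for a constant number of pairs costs.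

    The event is an uncountable union over channels. It is measurable because the supremum of the
    fidelity is attained and can be computed on a countable family. *)

Section RisingFactorials.
Variable R : realFieldType.
Implicit Types (x y S : R) (k : nat) (s : seq R).

(* The coefficient of [z ^ k] in [(1 - z) ^ (- x)]. *)
Definition rising x k : R := \prod_(j < k) ((x + j%:R) / j.+1%:R).

Lemma rising0 x : rising x 0 = 1.
Proof. by rewrite /rising big_ord0. Qed.

Lemma risingS x k : rising x k.+1 * k.+1%:R = (x + k%:R) * rising x k.
Proof.
rewrite /rising big_ord_recr /= -mulrA divfK ?pnatr_eq0 //; exact: mulrC.
Qed.

Lemma rising_gt0 x k : 0 < x -> 0 < rising x k.
Proof.
by move=> x0; apply: prodr_gt0 => j _; rewrite divr_gt0 // ltr_wpDr.
Qed.

Lemma rising1 k : rising 1 k = 1.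
Proof. by apply: big1 => j _; rewrite nat1r divff // pnatr_eq0. Qed.

(** Vandermonde's convolution: multiply the power series of [(1 - z)^(-x)] and [(1 - z)^(-y)]. In
    the induction the weight [k + 1] splits as [a + (k + 1 - a)], and each part is absorbed by
    [risingS] for one factor. *)
Lemma risingD x y k :
  rising (x + y) k = \sum_(a < k.+1) rising x a * rising y (k - a).
Proof.
elim: k => [|k IHk]; first by rewrite big_ord1 !rising0 mulr1.
have k1 : k.+1%:R != 0 :> R by rewrite pnatr_eq0.
apply: (mulIf k1); rewrite risingS IHk mulr_sumr mulr_suml.
rewrite (eq_bigr (fun a : 'I_k.+2 => (rising x a * a%:R) * rising y (k.+1 - a)
    + rising x a * (rising y (k.+1 - a) * (k.+1 - a)%:R))); last first.
  move=> a _; have -> : k.+1%:R = a%:R + (k.+1 - a)%:R :> R.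
    by rewrite -natrD subnKC // -ltnS.
  ring.
rewrite big_split /= [X in _ = X + _]big_ord_recl /= mulr0 mul0r add0r.
rewrite [X in _ = _ + X]big_ord_recr /= subnn mulr0 mulr0 addr0 -big_split /=.
apply: eq_bigr => a _; rewrite risingS subSS subSn ?risingS; last by rewrite -ltnS.
have -> : x + y + k%:R = (x + a%:R) + (y + (k - a)%:R).
  have -> : k%:R = a%:R + (k - a)%:R :> R by rewrite -natrD subnKC // -ltnS.
  ring.
ring.
Qed.

(* The complete homogeneous symmetric polynomial of degree [k]. *)
Fixpoint hsym s k : R :=
  if s is x :: s' then \sum_(a < k.+1) x ^+ a * hsym s' (k - a) else (k == 0%N)%:R.

(** For [0 <= x <= 1] each factor satisfies [x <= (x + j) / (j + 1)], hence [x^a <= rising x a];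
    [risingD] then sums the weights. *)
Lemma hsym_le s k : all (fun x => 0 <= x <= 1) s ->
  0 <= hsym s k <= rising (\sum_(x <- s) x) k.
Proof.
elim: s k => [|x s IHs] k /=.
  rewrite big_nil ler0n /= /rising; case: k => [|k] /=; first by rewrite big_ord0.
  by rewrite big_ord_recl addr0 !mul0r.
case/andP => /andP[x0 x1] /IHs {}IHs; apply/andP; split.
  by apply: sumr_ge0 => a _; rewrite mulr_ge0 ?exprn_ge0 //; case/andP: (IHs (k - a)%N).
rewrite big_cons risingD; apply: ler_sum => a _.
have /andP[h0 h1] := IHs (k - a)%N.
apply: ler_pM; rewrite ?exprn_ge0 // /rising -[X in _ ^+ X]card_ord -prodr_const.
apply: ler_prod => j _; rewrite x0 /= ler_pdivlMr // -natr1.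
have : 0 <= (1 - x) * j%:R by rewrite mulr_ge0 // subr_ge0.
by rewrite mulrDr mulrBl mul1r mulr1; lra.
Qed.

Lemma hsym_nseq1 n k : hsym (nseq n 1) k = rising n%:R k.
Proof.
elim: n k => [|n IHn] k /=.
  by rewrite /rising; case: k => [|k]; rewrite ?big_ord0 // big_ord_recl addr0 !mul0r.
rewrite -natr1 addrC risingD; apply: eq_bigr => a _.
by rewrite IHn expr1n rising1.
Qed.

Lemma rising_ratio x y k : 0 < y ->
  rising x k / rising y k = \prod_(j < k) ((x + j%:R) / (y + j%:R)).
Proof.
move=> y0; rewrite /rising -prodf_div; apply: eq_bigr => j _.
by field; rewrite nat1r pnatr_eq0 /= gt_eqF // ltr_wpDr.
Qed.

(** Jensen's inequality for [1 / t], with the mean [y + (k - 1) / 2] of the arguments rounded up to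
    [y + k / 2]. *)
Lemma sum_inv_arith y k : 0 < y ->
  k%:R / (y + k%:R / 2) <= \sum_(j < k) (y + j%:R)^-1.
Proof.
move=> y0; set u := y + k%:R / 2; have u0 : 0 < u by rewrite /u ltr_wpDr.
(* the tangent of [1 / t] at [u] *)
have tang (t : R) : 0 < t -> 2 / u - t / u ^+ 2 <= t^-1.
  move=> t0; rewrite -subr_ge0.
  have -> : t^-1 - (2 / u - t / u ^+ 2) = (u - t) ^+ 2 / (t * u ^+ 2).
    by field; rewrite !gt_eqF.
  by rewrite divr_ge0 ?sqr_ge0 // mulr_ge0 ?exprn_ge0 // ltW.
apply: (@le_trans _ _ (\sum_(j < k) (2 / u - (y + j%:R) / u ^+ 2))); last first.
  by apply: ler_sum => j _; apply: tang; rewrite ltr_wpDr.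
have -> : \sum_(j < k) (2 / u - (y + j%:R) / u ^+ 2) =
    (2 / u - y / u ^+ 2) *+ k - (\sum_(j < k) j%:R) / u ^+ 2.
  rewrite (eq_bigr (fun j : 'I_k => (2 / u - y / u ^+ 2) - j%:R / u ^+ 2)).
    by rewrite sumrB sumr_const card_ord mulr_suml.
  by move=> j _; ring.
have sumj : 2 * \sum_(j < k) j%:R <= k%:R ^+ 2 :> R.
  elim: k {u u0 tang} => [|k IHk]; first by rewrite big_ord0 mulr0 sqr_ge0.
  by rewrite big_ord_recr /= mulrDr -[k.+1%:R]natr1 sqrrD; lra.
have -> : k%:R / u = (2 / u - y / u ^+ 2) *+ k - (k%:R ^+ 2 / 2) / u ^+ 2.
  by rewrite -mulr_natr; move: (gt_eqF u0); rewrite /u => /negbT uN; field;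
     apply: contraNN uN => /eqP h; apply/eqP; lra.
rewrite lerD2l lerN2 ler_pM2r ?invr_gt0 ?exprn_gt0 //; lra.
Qed.

End RisingFactorials.

(** * Bounded measurable functions on the unit sphere *)

Lemma measurable_bigsum d (T : measurableType d) (R : realType) (J : Type)
    (r : seq J) (Q : pred J) (F : J -> T -> R) :
  (forall j, measurable_fun setT (F j)) ->
  measurable_fun setT (fun x => \sum_(j <- r | Q j) F j x).
Proof.
move=> mF; elim: r => [|j r IHr].
  by under eq_fun do rewrite big_nil; exact: measurable_cst.
under eq_fun do rewrite big_cons.
by case: (Q j) => //; exact: measurable_funD.
Qed.

Section UnitSphere.
Variables (R : realType) (I : finType).
Local Notation C := R[i].

(** A name of its own, to which the sigma-algebra [borelC] can be attached. *)
Definition cvec := I -> C.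

HB.instance Definition _ := Choice.on cvec.
HB.instance Definition _ := isPointed.Build cvec (fun=> 0).
HB.instance Definition _ := @isMeasurable.Build (sigma_display (@coord_gen R I))
  cvec (@borelC R I) (@sigma_algebra0 _ setT _)
  (fun A => @sigma_algebraC _ _ A) (@sigma_algebra_bigcup _ setT _).

Definition unitv (v : cvec) := \sum_(i : I) `|v i| ^+ 2 = 1.

(** Polynomials in the amplitudes are bounded only on the sphere, and that is where [psi] takes its
    values; [good] is thus stable under products and yields integrability. *)
Definition good (g : cvec -> R) :=
  measurable_fun setT g /\ exists M, forall v, unitv v -> `|g v| <= M.

Lemma good_cst x : good (fun=> x).
Proof. by split=> //; exists `|x|. Qed.

Lemma goodD f g : good f -> good g -> good (fun v => f v + g v).
Proof.
move=> [mf [M fM]] [mg [N gN]]; split; first exact: measurable_funD.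
by exists (M + N) => v uv; rewrite (le_trans (ler_normD _ _)) // lerD ?fM ?gN.
Qed.

Lemma goodM f g : good f -> good g -> good (fun v => f v * g v).
Proof.
move=> [mf [M fM]] [mg [N gN]]; split; first exact: measurable_funM.
by exists (M * N) => v uv; rewrite normrM ler_pM ?fM ?gN.
Qed.

Lemma goodN f : good f -> good (fun v => - f v).
Proof.
move=> /(goodM (good_cst (-1))).
by congr good; apply/funext => v; rewrite mulN1r.
Qed.

Lemma goodB f g : good f -> good g -> good (fun v => f v - g v).
Proof. by move=> gf gg; apply: goodD => //; apply: goodN. Qed.

Lemma goodX f n : good f -> good (fun v => f v ^+ n).
Proof.
move=> gf; elim: n => [|n IHn]; first exact: good_cst.
have := goodM gf IHn; congr good.
by apply/funext => v; rewrite exprS.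
Qed.

Lemma good_sum J (r : seq J) (Q : pred J) (F : J -> cvec -> R) :
  (forall j, good (F j)) -> good (fun v => \sum_(j <- r | Q j) F j v).
Proof.
move=> gF; elim: r => [|j r IHr].
  have := good_cst 0; congr good; apply/funext => v; by rewrite big_nil.
have : good (fun v => (if Q j then F j v else 0) + \sum_(k <- r | Q k) F k v).
  by apply: goodD IHr; case: (Q j); [exact: gF|exact: good_cst].
congr good; apply/funext => v; rewrite big_cons.
by case: (Q j); rewrite ?add0r.
Qed.

Lemma measurable_re i : measurable_fun setT (fun v : cvec => complex.Re (v i)).
Proof.
move=> _ B mB; rewrite setTI; apply: sub_sigma_algebra.
by exists i, B; split => //; left.
Qed.

Lemma measurable_im i : measurable_fun setT (fun v : cvec => complex.Im (v i)).
Proof.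
move=> _ B mB; rewrite setTI; apply: sub_sigma_algebra.
by exists i, B; split => //; right.
Qed.

Definition sqn (v : cvec) i : R := complex.Re (v i) ^+ 2 + complex.Im (v i) ^+ 2.

Lemma sqn_ge0 v i : 0 <= sqn v i.
Proof. by rewrite addr_ge0 ?sqr_ge0. Qed.

Lemma sqnE v i : `|v i| ^+ 2 = (sqn v i)%:C%C.
Proof. by rewrite /sqn add_Re2_Im2. Qed.

Lemma unitvE v : unitv v <-> \sum_i sqn v i = 1.
Proof.
rewrite /unitv (eq_bigr _ (fun i _ => sqnE v i)) -rmorph_sum.
by split=> [|->]; [move=> /(congr1 (@complex.Re R))|].
Qed.

Lemma unitv_sqn_le1 v i : unitv v -> sqn v i <= 1.
Proof.
move=> /unitvE <-; rewrite (bigD1 i) //= lerDl.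
by apply: sumr_ge0 => j _; exact: sqn_ge0.
Qed.

Lemma good_re i : good (fun v => complex.Re (v i)).
Proof.
split; first exact: measurable_re.
exists 1 => v /(unitv_sqn_le1 i); rewrite /sqn => h.
rewrite -(@ler_pXn2r _ 2) ?nnegrE // expr1n real_normK ?num_real //.
by have := sqr_ge0 (complex.Im (v i)); lra.
Qed.

Lemma good_im i : good (fun v => complex.Im (v i)).
Proof.
split; first exact: measurable_im.
exists 1 => v /(unitv_sqn_le1 i); rewrite /sqn => h.
rewrite -(@ler_pXn2r _ 2) ?nnegrE // expr1n real_normK ?num_real //.
by have := sqr_ge0 (complex.Re (v i)); lra.
Qed.

Lemma good_sqn i : good (sqn^~ i).
Proof. by apply: goodD; apply: goodX; [exact: good_re|exact: good_im]. Qed.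

Lemma sum_delta (T : finType) (A : pzRingType) (i : T) (F : T -> A) :
  \sum_j (j == i)%:R * F j = F i.
Proof.
rewrite (bigD1 i) //= eqxx mul1r big1 ?addr0 // => j /negPf ->.
by rewrite mul0r.
Qed.

Lemma op_apply_unitv (U : op R I) v : unitary U -> unitv v -> unitv (op_apply U v).
Proof.
move=> uU; rewrite /unitv => <-.
transitivity (\sum_i \sum_j \sum_k ((U i k)^* * U i j) * (v j * (v k)^*)).
  apply: eq_bigr => i _; rewrite normCK /op_apply rmorph_sum mulr_suml.
  apply: eq_bigr => j _; rewrite mulr_sumr; apply: eq_bigr => k _.
  by rewrite rmorphM; ring.
rewrite exchange_big /=; apply: eq_bigr => j _; rewrite exchange_big /=.
rewrite normCK (eq_bigr (fun k => (k == j)%:R * (v j * (v k)^*))).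
  by rewrite sum_delta.
by move=> k _; rewrite -mulr_suml uU.
Qed.

Lemma measurable_op_apply (U : op R I) :
  measurable_fun setT (op_apply U : cvec -> cvec).
Proof.
pose re k := measurable_re k; pose im k := measurable_im k.
apply: (@measurability _ _ cvec cvec setT (op_apply U) (@coord_gen R I) erefl).
move=> _ [_ [i [B [mB [->|->]]]] <-].
  suff mh : measurable_fun setT (fun v : cvec => complex.Re (op_apply U v i)).
    by have := mh measurableT _ mB; rewrite setTI.
  have -> : (fun v : cvec => complex.Re (op_apply U v i)) = (fun v : cvec =>
      \sum_j (complex.Re (U i j) * complex.Re (v j)
              - complex.Im (U i j) * complex.Im (v j))).
    apply/funext => v; rewrite /op_apply (raddf_sum (@complex.Re R)).
    by apply: eq_bigr => j _; case: (U i j) => a b; case: (v j).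
  apply: measurable_bigsum => j; apply: measurable_funB;
    by apply: measurable_funM => //; apply: measurable_cst.
suff mh : measurable_fun setT (fun v : cvec => complex.Im (op_apply U v i)).
  by have := mh measurableT _ mB; rewrite setTI.
have -> : (fun v : cvec => complex.Im (op_apply U v i)) = (fun v : cvec =>
    \sum_j (complex.Re (U i j) * complex.Im (v j)
            + complex.Im (U i j) * complex.Re (v j))).
  apply/funext => v; rewrite /op_apply (raddf_sum (@complex.Im R)).
  by apply: eq_bigr => j _; case: (U i j) => a b; case: (v j).
apply: measurable_bigsum => j; apply: measurable_funD;
  by apply: measurable_funM => //; apply: measurable_cst.
Qed.

Lemma good_op_apply (U : op R I) g : unitary U -> good g -> good (g \o op_apply U).
Proof.
move=> uU [mg [M gM]]; split.
  by apply: measurableT_comp => //; exact: measurable_op_apply.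
by exists M => v uv; apply: gM; exact: op_apply_unitv.
Qed.

End UnitSphere.

Lemma poly_eq_horner (R : numFieldType) (p q : {poly R}) :
  (forall x, p.[x] = q.[x]) -> p = q.
Proof.
move=> pq; apply/eqP; rewrite -subr_eq0; apply/negPn/negP => nz.
have := @max_poly_roots R (p - q) [seq i%:R | i <- iota 0 (size (p - q))] nz.
rewrite size_map size_iota ltnn => H; suff: false by [].
apply: H; first by apply/allP => x _; rewrite /root !hornerE pq subrr.
rewrite map_inj_uniq ?iota_uniq // => i j /eqP.
by rewrite eqr_nat => /eqP.
Qed.

(** * Rotations of a coordinate plane and a quarter phase *)

Section PlaneRotation.
Variables (R : realType) (I : finType).
Local Notation C := R[i].
Local Notation cvec := (cvec R I).
Variables i j : I.
Hypothesis ij : i != j.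

(** The cosine of the angle with tangent [t]. In this parameter rotated quadratic quantities are
    polynomials in [t] divided by [1 + t^2], so a derivative at 0 becomes a coefficient. *)
Definition rot_scale (t : R) : R := (Num.sqrt (1 + t ^+ 2))^-1.

Definition rot_entry (t : R) (k l : I) : R :=
  if k == i then rot_scale t * ((l == i)%:R + t * (l == j)%:R)
  else if k == j then rot_scale t * ((l == j)%:R - t * (l == i)%:R)
  else (l == k)%:R.

Definition rot (t : R) : op R I := fun k l => (rot_entry t k l)%:C%C.

(** Multiplying [v_j] by [i] turns the real part of [conj v_i v_j] into minus its imaginary part.
    The squares of the two add up to [|v_i|^2 |v_j|^2], so this single unitary replaces an average
    over all phases. *)
Definition phase : op R I := fun k l =>
  (if k == j then 'i%C else 1) * (l == k)%:R.

Lemma rot_scale2 t : rot_scale t ^+ 2 * (1 + t ^+ 2) = 1.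
Proof.
have t1 : 0 < 1 + t ^+ 2 by rewrite ltr_pwDl ?sqr_ge0.
by rewrite /rot_scale exprVn sqr_sqrtr ?ltW // mulVf // gt_eqF.
Qed.

Lemma rot_unitary t : unitary (rot t).
Proof.
move=> a b; rewrite /rot.
under eq_bigr do rewrite [_^*]conjc_real -rmorphM.
rewrite -rmorph_sum -(rmorph_nat (real_complex R)); congr (_%:C%C).
rewrite (bigD1 i) //= (bigD1 j) 1?eq_sym //=.
have -> : \sum_(k | (k != i) && (k != j)) rot_entry t k a * rot_entry t k b
    = ((a == b) && (a != i) && (a != j))%:R.
  case: (boolP ((a != i) && (a != j))) => [aij|naij]; last first.
    rewrite -andbA (negPf naij) andbF big1 // => k /andP[ki kj].
    rewrite {1}/rot_entry (negPf ki) (negPf kj); case: (eqVneq a k) naij => [->|].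
      by rewrite ki kj.
    by rewrite mul0r.
  have [ai aj] := andP aij; rewrite (bigD1 a) //= big1 ?addr0.
    by rewrite /rot_entry (negPf ai) (negPf aj) eqxx mul1r eq_sym !andbT.
  move=> k /andP[/andP[/negPf ki /negPf kj] ka].
  by rewrite /rot_entry ki kj eq_sym (negPf ka) mul0r.
have sc := rot_scale2 t; have ji : (j == i) = false by rewrite eq_sym (negPf ij).
rewrite /rot_entry !eqxx ji.
have [->|ai] := eqVneq a i; rewrite ?eqxx ?(negPf ij) /=.
  have [eb|bi] := eqVneq i b; rewrite -?eb ?eqxx ?(negPf ij) /=.
    by rewrite -[RHS]sc; ring.
  by have [eb|bj] := eqVneq b j; rewrite ?eb ?eqxx /=; ring.
have [->|aj] := eqVneq a j; rewrite ?eqxx ?ji /=.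
  have [eb|bj] := eqVneq j b; rewrite -?eb ?eqxx ?ji /=.
    by rewrite -[RHS]sc; ring.
  by have [eb|bi] := eqVneq b i; rewrite ?eb ?eqxx ?ji /=; ring.
by rewrite !andbT [b == a]eq_sym; ring.
Qed.

Lemma phase_unitary : unitary phase.
Proof.
have ii : ('i%C)^* * 'i%C = 1 :> C.
  apply/eqP; rewrite eq_complex /=.
  by rewrite !(mul0r, mulr0, mulN1r, mulr1, opprK, oppr0, addr0, subr0, sub0r, add0r) !eqxx.
move=> a b; rewrite /phase.
rewrite (eq_bigr (fun k => (k == a)%:R * (a == b)%:R)) ?sum_delta // => k _.
rewrite rmorphM rmorph_nat [a == k]eq_sym [b == k]eq_sym.
case: (eqVneq k a) => [->|]; last by rewrite mulr0 !mul0r.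
case: eqP => _; last by rewrite rmorph1 !mul1r.
by rewrite mulr1 mul1r mulrA ii mul1r.
Qed.

Lemma rot_applyi t (v : cvec) : op_apply (rot t) v i = (rot_scale t)%:C%C * (v i + t%:C%C * v j).
Proof.
rewrite /op_apply /rot /rot_entry eqxx.
under eq_bigr do rewrite rmorphM rmorphD rmorphM !rmorph_nat -mulrA mulrDl -mulrA.
by rewrite -mulr_sumr big_split /= -mulr_sumr !sum_delta.
Qed.

Lemma rot_applyj t (v : cvec) : op_apply (rot t) v j = (rot_scale t)%:C%C * (v j - t%:C%C * v i).
Proof.
rewrite /op_apply /rot /rot_entry eqxx eq_sym (negPf ij).
under eq_bigr do rewrite rmorphM rmorphB rmorphM !rmorph_nat -mulrA mulrBl -mulrA.
by rewrite -mulr_sumr sumrB /= -mulr_sumr !sum_delta.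
Qed.

Lemma rot_applyN t (v : cvec) k : k != i -> k != j -> op_apply (rot t) v k = v k.
Proof.
move=> /negPf ki /negPf kj; rewrite /op_apply /rot /rot_entry ki kj.
by under eq_bigr do rewrite rmorph_nat; rewrite sum_delta.
Qed.

Lemma phase_apply (v : cvec) k :
  op_apply phase v k = (if k == j then 'i%C else 1) * v k.
Proof.
rewrite /op_apply /phase; under eq_bigr do rewrite -mulrA.
by rewrite -mulr_sumr sum_delta.
Qed.

(** This is [2 Re (conj v_i v_j)], the first-order change of [sqn v i] along [rot t]. *)
Definition cross (v : cvec) : R :=
  2 * (complex.Re (v i) * complex.Re (v j) + complex.Im (v i) * complex.Im (v j)).

Lemma rot_sqni t v :
  sqn (op_apply (rot t) v) i = rot_scale t ^+ 2 * (sqn v i + t * cross v + t ^+ 2 * sqn v j).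
Proof.
rewrite /sqn /cross rot_applyi; case: (v i) => a b; case: (v j) => a' b' /=; ring.
Qed.

Lemma rot_sqnj t v :
  sqn (op_apply (rot t) v) j = rot_scale t ^+ 2 * (sqn v j - t * cross v + t ^+ 2 * sqn v i).
Proof.
rewrite /sqn /cross rot_applyj; case: (v i) => a b; case: (v j) => a' b' /=; ring.
Qed.

Lemma rot_cross t v :
  cross (op_apply (rot t) v) =
  rot_scale t ^+ 2 * (cross v + t * (2 * (sqn v j - sqn v i)) - t ^+ 2 * cross v).
Proof.
rewrite /sqn /cross rot_applyi rot_applyj.
by case: (v i) => a b; case: (v j) => a' b' /=; ring.
Qed.

Lemma phase_sqn v k : sqn (op_apply phase v) k = sqn v k.
Proof.
rewrite /sqn phase_apply; case: (v k) => a b; case: eqP => _ /=; ring.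
Qed.

Lemma phase_cross v :
  cross v ^+ 2 + cross (op_apply phase v) ^+ 2 = 4 * (sqn v i * sqn v j).
Proof.
rewrite /sqn /cross !phase_apply eqxx (negPf ij).
by case: (v i) => a b; case: (v j) => a' b' /=; ring.
Qed.

Lemma good_cross : good cross.
Proof.
apply: goodM; first exact: good_cst.
by apply: goodD; apply: goodM; (exact: good_re || exact: good_im).
Qed.

End PlaneRotation.

(** * Moments of a Haar random vector *)

Section HaarMoments.
Variables (R : realType) (I : finType).
Local Notation C := R[i].
Local Notation cvec := (cvec R I).
Variables (dsp : measure_display) (Omega : measurableType dsp).
Variables (P : probability Omega R) (psi : Omega -> I -> C).
Hypothesis haar : haar_random P psi.

Let psi_unitv w : unitv (psi w : cvec).
Proof. by case: haar => hu _ _; exact: hu. Qed.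

Lemma haar_measurable : measurable_fun setT (psi : Omega -> cvec).
Proof. by case: haar => _ mpsi _ _ B mB; rewrite setTI; apply: mpsi. Qed.

Definition Ex (g : cvec -> R) : R := \int[P]_w g (psi w).

Lemma good_integrable g : good g -> P.-integrable setT (EFin \o (g \o psi)).
Proof.
move=> [mg [M gM]]; apply: measurable_bounded_integrable => //.
- by rewrite (@le_lt_trans _ _ 1%E) ?ltry // probability_le1.
- by apply: measurableT_comp => //; exact: haar_measurable.
- exists M; split; rewrite ?num_real // => x Mx w _ /=.
  exact: le_trans (gM _ (psi_unitv w)) (ltW Mx).
Qed.

Lemma Ex_cst x : Ex (fun=> x) = x.
Proof.
rewrite /Ex Rintegral_cst //=.
by have -> : P [set: Omega] = 1%E := probability_setT P; rewrite /= mulr1.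
Qed.

Lemma ExD f g : good f -> good g -> Ex (fun v => f v + g v) = Ex f + Ex g.
Proof. by move=> gf gg; rewrite /Ex RintegralD //; exact: good_integrable. Qed.

Lemma ExZ x f : good f -> Ex (fun v => x * f v) = x * Ex f.
Proof. by move=> gf; rewrite /Ex RintegralZl //; exact: good_integrable. Qed.

Lemma eq_Ex f g : (forall v, unitv v -> f v = g v) -> Ex f = Ex g.
Proof. by move=> fg; apply: eq_Rintegral => w _; exact: fg. Qed.

Lemma Ex_sum J (r : seq J) (F : J -> cvec -> R) :
  (forall j, good (F j)) ->
  Ex (fun v => \sum_(j <- r) F j v) = \sum_(j <- r) Ex (F j).
Proof.
move=> gF; elim: r => [|j r IHr].
  by rewrite big_nil -[RHS]Ex_cst; apply: eq_Ex => v _; rewrite big_nil.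
rewrite big_cons -IHr -ExD //; last exact: good_sum.
by apply: eq_Ex => v _; rewrite big_cons.
Qed.

Lemma le_Ex f g : good f -> good g ->
  (forall v, unitv v -> f v <= g v) -> Ex f <= Ex g.
Proof.
move=> gf gg fg; apply: le_Rintegral => //; try exact: good_integrable.
by move=> w _; exact: fg.
Qed.

(** [haar_random] asserts that two pushforward measures agree on Borel sets; a change of variables
    carries this over to integrals. *)
Lemma Ex_op_apply (U : op R I) g : unitary U -> good g ->
  Ex (g \o op_apply U) = Ex g.
Proof.
move=> uU gg; have mpsi := haar_measurable.
have mU : measurable_fun setT ((op_apply U : cvec -> cvec) \o psi).
  by apply: measurableT_comp => //; exact: measurable_op_apply.
have mg : measurable_fun setT (EFin \o g) by apply/measurable_EFinP; case: gg.
have gU := good_op_apply uU gg.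
rewrite /Ex /Rintegral; congr fine.
transitivity (\int[pushforward P ((op_apply U : cvec -> cvec) \o psi)]_y (g y)%:E)%E.
  by rewrite integral_pushforward //; exact: (good_integrable gU).
transitivity (\int[pushforward P (psi : Omega -> cvec)]_y (g y)%:E)%E; last first.
  by rewrite integral_pushforward //; exact: (good_integrable gg).
apply: eq_measure_integral => A mA _ /=; rewrite /pushforward.
by case: haar => _ _ inv; rewrite (inv _ _ uU mA).
Qed.

(** Random polynomials in [t]. The degree bound is uniform in [v], so that the expectation is again
    a polynomial, taken coefficient by coefficient. *)
Definition pgood (Q : cvec -> {poly R}) :=
  (forall n, good (fun v => (Q v)`_n)) /\ exists N, forall v, (size (Q v) <= N)%N.

Lemma pgoodM A B : pgood A -> pgood B -> pgood (fun v => A v * B v).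
Proof.
move=> [gA [NA hA]] [gB [NB hB]]; split=> [n|].
  have : good (fun v => \sum_(j <- enum 'I_n.+1) (A v)`_j * (B v)`_(n - j)).
    by apply: good_sum => j; apply: goodM.
  by congr good; apply/funext => v; rewrite coefM -big_enum.
exists (NA + NB)%N => v; apply: leq_trans (size_polyMleq _ _) _.
by rewrite (leq_trans (leq_pred _)) // leq_add.
Qed.

Lemma pgoodX A n : pgood A -> pgood (fun v => A v ^+ n).
Proof.
move=> gA; elim: n => [|n IHn].
  split; [move=> k; exact: (good_cst _ (1 : {poly R})`_k) | by exists 1%N => v; rewrite size_poly1].
by have := pgoodM gA IHn; congr pgood; apply/funext => v; rewrite exprS.
Qed.

Lemma pgood2 a b c : good a -> good b -> good c ->
  pgood (fun v => (a v)%:P + (b v)%:P * 'X + (c v)%:P * 'X^2).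
Proof.
move=> ga gb gc; split=> [n|]; last first.
  exists 3%N => v; apply/leq_sizeP => j; rewrite !coefD !coefMXn coefMX !coefC.
  by case: j => [|[|[|j]]] //= _; rewrite !addr0.
have : good (fun v => a v * (n == 0%N)%:R + b v * (n == 1%N)%:R + c v * (n == 2%N)%:R).
  by apply: goodD; [apply: goodD|]; apply: goodM => //; exact: good_cst.
congr good; apply/funext => v; rewrite !coefD !coefMXn coefMX !coefC.
by case: n => [|[|[|n]]] /=; rewrite ?(mulr0, mulr1, addr0, add0r).
Qed.

Lemma pgoodC a : good a -> pgood (fun v => (a v)%:P).
Proof.
move=> ga; have := pgood2 ga (good_cst _ 0) (good_cst _ 0).
by congr pgood; apply/funext => v; rewrite !mul0r !addr0.
Qed.

(** Both sides are polynomials in [t] and the right one is even, so its linear coefficient vanishes.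
    This stands in for differentiation under the integral sign. *)
Lemma Ex_first_order Q x k : pgood Q ->
  (forall t, Ex (fun v => (Q v).[t]) = x * (1 + t ^+ 2) ^+ k) ->
  Ex (fun v => (Q v)`_1) = 0.
Proof.
move=> [gQ [N sQ]] H.
have pE : \poly_(n < N) Ex (fun v => (Q v)`_n) = x *: (1 + 'X^2) ^+ k.
  apply: poly_eq_horner => t; rewrite horner_poly !hornerE -H.
  transitivity (Ex (fun v => \sum_(n <- enum 'I_N) (Q v)`_n * t ^+ n)).
    rewrite Ex_sum; last by move=> n; apply: goodM; [|exact: good_cst].
    rewrite big_enum; apply: eq_bigr => n _; rewrite mulrC -ExZ //.
    by apply: eq_Ex => v _; rewrite mulrC.
  by apply: eq_Ex => v _; rewrite big_enum /= (horner_coef_wide t (sQ v)).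
have := congr1 (fun p : {poly R} => p^`().[0]) pE.
have d0 : (x *: (1 + 'X^2) ^+ k)^`().[0] = 0 :> R.
  rewrite derivZ deriv_exp derivD derivXn derivC !hornerE /=.
  by rewrite hornerMn hornerM hornerMn hornerX mul0rn mul0r mul0rn mulr0.
rewrite d0 horner_coef0 coef_deriv coef_poly mulr1n; case: ltnP => // N1 _.
rewrite -[RHS](Ex_cst 0); apply: eq_Ex => v _.
by move/leq_sizeP: (sQ v); apply.
Qed.

Section Merge.
Variables i j : I.
Hypothesis ij : i != j.
Variable g : cvec -> R.
Hypotheses (gg : good g) (g_rot : forall t v, g (op_apply (rot i j t) v) = g v)
  (g_phase : forall v, g (op_apply (phase R j) v) = g v).

(* The derivative at [t = 0] of [p_i ^ a p_j ^ b (2 Re (conj v_i v_j)) g] along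
   [rot i j t] has mean zero; averaging over the phase of [v_j] turns
   [(2 Re (conj v_i v_j)) ^ 2] into [2 p_i p_j]. *)
Lemma Ex_shift a b :
  a.+1%:R * Ex (fun v => sqn v i ^+ a * sqn v j ^+ b.+1 * g v) =
  b.+1%:R * Ex (fun v => sqn v i ^+ a.+1 * sqn v j ^+ b * g v).
Proof.
(* The derivative plus its copy after [phase], where [x] and [y] are the two values of the squared
   cross term; only [x + y] survives. The factors [a] and [b] neutralise the predecessors at 0. *)
have key (X Y Z x y : R) : y = 4 * (X * Y) - x ->
    a%:R * X ^+ a.-1 * x * Y ^+ b * Z - b%:R * Y ^+ b.-1 * x * X ^+ a * Z
    + 2 * X ^+ a * Y ^+ b * (Y - X) * Z
    + (a%:R * X ^+ a.-1 * y * Y ^+ b * Z - b%:R * Y ^+ b.-1 * y * X ^+ a * Z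
       + 2 * X ^+ a * Y ^+ b * (Y - X) * Z)
    = 4 * (a.+1%:R * (X ^+ a * Y ^+ b.+1 * Z) + (- b.+1%:R) * (X ^+ a.+1 * Y ^+ b * Z)).
  move=> ->; rewrite -![_.+1%:R]natr1.
  by case: a b => [|a'] [|b'] /=; rewrite !exprS; ring.
pose p (v : cvec) : R := sqn v i; pose q (v : cvec) : R := sqn v j.
pose c (v : cvec) : R := cross i j v.
have gp : good p := good_sqn R i; have gq : good q := good_sqn R j.
have gc : good c := good_cross R i j.
(* Along the rotation [p], [q], [c] become [rot_scale t ^+ 2] times [A], [B], [D] at [t]. The
   [a + b + 1] scale factors of the integrand cancel against [(1 + t^2)^(a + b + 1)]. *)
pose A v : {poly R} := (p v)%:P + (c v)%:P * 'X + (q v)%:P * 'X^2.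
pose B v : {poly R} := (q v)%:P + (- c v)%:P * 'X + (p v)%:P * 'X^2.
pose D v : {poly R} := (c v)%:P + (2 * (q v - p v))%:P * 'X + (- c v)%:P * 'X^2.
pose Q v : {poly R} := A v ^+ a * B v ^+ b * D v * (g v)%:P.
pose G v : R := p v ^+ a * q v ^+ b * c v * g v.
have gG : good G by do 3 apply: goodM => //; apply: goodX.
have gQ : pgood Q.
  apply: pgoodM; last exact: pgoodC.
  apply: pgoodM.
    by apply: pgoodM; apply: pgoodX; apply: pgood2 => //; exact: goodN.
  apply: pgood2 => //; last exact: goodN.
  by apply: goodM; [exact: good_cst | exact: goodB].
have EQ : Ex (fun v => (Q v)`_1) = 0.
  apply: (@Ex_first_order Q (Ex G) (a + b).+1 gQ) => t.
  rewrite -(Ex_op_apply (rot_unitary ij t) gG) mulrC -ExZ; last first.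
    exact: good_op_apply (rot_unitary ij t) gG.
  apply: eq_Ex => v _; rewrite /G /= /p /q /c rot_sqni // rot_sqnj // rot_cross // g_rot.
  have h2 (x y z : R) : (x%:P + y%:P * 'X + z%:P * 'X^2).[t] = x + t * y + t ^+ 2 * z.
    by rewrite !hornerD !hornerM !hornerC !hornerX; ring.
  have -> : (Q v).[t] = (A v).[t] ^+ a * (B v).[t] ^+ b * (D v).[t] * g v.
    by rewrite /Q !hornerM !horner_exp hornerC.
  rewrite !h2.
  have -> : (1 + t ^+ 2) ^+ (a + b).+1 =
      (1 + t ^+ 2) ^+ a * (1 + t ^+ 2) ^+ b * (1 + t ^+ 2).
    by rewrite exprS exprD; ring.
  have s1 := rot_scale2 t; move: s1.
  set S := rot_scale t ^+ 2; set T := 1 + t ^+ 2 => s1.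
  have fold (Y Z W g0 : R) : T ^+ a * T ^+ b * T * ((S * Y) ^+ a * (S * Z) ^+ b * (S * W) * g0)
      = (S * T) ^+ a * (S * T) ^+ b * (S * T) * (Y ^+ a * Z ^+ b * W * g0).
    by rewrite !exprMn; ring.
  rewrite fold s1 !expr1n !mul1r /p /q /c.
  by congr (_ ^+ _ * _ ^+ _ * _ * _); ring.
(* The linear coefficient of [Q v], by the product rule. *)
pose F v : R := a%:R * p v ^+ a.-1 * c v ^+ 2 * q v ^+ b * g v
  - b%:R * q v ^+ b.-1 * c v ^+ 2 * p v ^+ a * g v
  + 2 * p v ^+ a * q v ^+ b * (q v - p v) * g v.
have gF : good F.
  apply: goodD; [apply: goodB|]; do ?(apply: goodM => //); do ?(apply: goodX => //);
  do ?(exact: good_cst); exact: goodB.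
have EF : Ex F = 0.
  rewrite -EQ; apply: eq_Ex => v _; rewrite /F.
  have -> : (Q v)`_1 = (Q v)^`().[0] by rewrite horner_coef0 coef_deriv mulr1n.
  have d0 (x y z : R) : (x%:P + y%:P * 'X + z%:P * 'X^2).[0] = x.
    by rewrite horner_coef0 !coefD !coefCM coefC coefX coefXn !mulr0 !addr0.
  have d1 (x y z : R) : (x%:P + y%:P * 'X + z%:P * 'X^2)^`().[0] = y.
    by rewrite horner_coef0 coef_deriv mulr1n !coefD !coefCM coefC coefX coefXn mulr1 mulr0 addr0 add0r.
  have dQ (X Y Z : {poly R}) (g0 : R) : (X ^+ a * Y ^+ b * Z * g0%:P)^`().[0] =
      (X^`().[0] * X.[0] ^+ a.-1 *+ a * Y.[0] ^+ b * Z.[0]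
      + X.[0] ^+ a * (Y^`().[0] * Y.[0] ^+ b.-1 *+ b) * Z.[0]
      + X.[0] ^+ a * Y.[0] ^+ b * Z^`().[0]) * g0.
    rewrite !derivM !deriv_exp derivC mulr0 addr0 !hornerM hornerC !hornerD !hornerM.
    by rewrite !(hornerD, hornerM, hornerMn, horner_exp); congr (_ * _); ring.
  rewrite (dQ (A v) (B v) (D v) (g v)) !(d0 (p v) (c v), d0 (q v) (- c v)).
  rewrite !(d0 (c v), d1 (p v), d1 (q v), d1 (c v)) -[_ *+ a]mulr_natl -[_ *+ b]mulr_natl.
  move: (p v) (q v) (c v) (g v) => X Y Z W; ring.
have pU := phase_unitary R j.
have : Ex (fun v => F v + F (op_apply (phase R j) v)) = 0.
  by rewrite ExD //; [rewrite (Ex_op_apply pU gF) EF addr0 | exact: good_op_apply].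
rewrite (@eq_Ex _ (fun v => 4 * (a.+1%:R * (p v ^+ a * q v ^+ b.+1 * g v)
    + (- b.+1%:R) * (p v ^+ a.+1 * q v ^+ b * g v)))); last first.
  move=> v _; rewrite /F /p /q /c !phase_sqn g_phase.
  have := phase_cross ij v.
  move: (cross i j v ^+ 2) (cross i j (op_apply _ v) ^+ 2) => x y xy.
  have {xy} : y = 4 * (sqn v i * sqn v j) - x by rewrite -xy addrC addKr.
  exact: key.
have ga (x y : nat) : good (fun v => p v ^+ x * q v ^+ y * g v).
  by do 2 apply: goodM => //; apply: goodX.
rewrite ExZ; last by apply: goodD; apply: goodM => //; exact: good_cst.
rewrite ExD; try by apply: goodM => //; exact: good_cst.
rewrite !ExZ // => /eqP; rewrite mulf_eq0 pnatr_eq0 /= mulNr subr_eq0 => /eqP.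
by [].
Qed.

(** [Ex_shift] moves the exponents from [i] to [j] one at a time; its factors accumulate to the Beta
    ratio [a! b! / (a + b)!]. *)
Lemma Ex_merge a b :
  (a + b)`!%:R * Ex (fun v => sqn v i ^+ a * sqn v j ^+ b * g v) =
  (a`! * b`!)%:R * Ex (fun v => sqn v j ^+ (a + b) * g v).
Proof.
elim: a b => [|a IHa] b.
  by rewrite !add0n fact0 mul1n; congr (_ * _); apply: eq_Ex => v _; rewrite mul1r.
have b1 : b.+1%:R != 0 :> R by rewrite pnatr_eq0.
apply: (mulfI b1); rewrite mulrCA -Ex_shift mulrCA addSnnS IHa !mulrA -!natrM.
by congr (_%:R * _); rewrite !factS; lia.
Qed.

End Merge.

End HaarMoments.

Section HaarDiagonal.
Variables (R : realType) (I : finType).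
Local Notation C := R[i].
Local Notation cvec := (cvec R I).
Variables (dsp : measure_display) (Omega : measurableType dsp).
Variables (P : probability Omega R) (psi : Omega -> I -> C).
Hypothesis haar : haar_random P psi.
Local Notation Ex := (Ex P psi).

Definition wsum (lam : I -> R) (s : seq I) (v : cvec) : R :=
  \sum_(i <- s) lam i * sqn v i.

Lemma good_wsum lam s : good (wsum lam s).
Proof. by apply: good_sum => i; apply: goodM; [exact: good_cst|exact: good_sqn]. Qed.

(** Each coordinate of [s] is merged into the pivot [j], which raises the pivot's exponent; hence
    the generalisation over [l]. The binomial coefficients cancel the factorials of [Ex_merge], and
    the remaining sum is the recursion of [hsym]. *)
Lemma Ex_wsum_pivot (lam : I -> R) (j : I) (s : seq I) k l : uniq s -> j \notin s ->
  Ex (fun v => wsum lam s v ^+ k * sqn v j ^+ l) =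
  (k`! * l`!)%:R * hsym [seq lam i | i <- s] k
    * (Ex (fun v => sqn v j ^+ (k + l)) / (k + l)`!%:R).
Proof.
have fact_nz n : n`!%:R != 0 :> R by rewrite pnatr_eq0 -lt0n fact_gt0.
elim: s k l => [|i s IHs] k l.
  move=> _ _ /=; case: k => [|k].
    rewrite mul1n mulr1 mulrCA divff // mulr1.
    by apply: (eq_Ex haar) => v _; rewrite expr0 mul1r.
  rewrite mulr0 mul0r -[RHS](Ex_cst P psi 0); apply: (eq_Ex haar) => v _.
  by rewrite /wsum big_nil exprS !mul0r.
rewrite /= inE negb_or => /andP[is_ us] /andP[ji js].
have ij : i != j by rewrite eq_sym.
transitivity (Ex (fun v => \sum_(a <- enum 'I_k.+1) ('C(k, a)%:R * lam i ^+ a) *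
    (sqn v i ^+ a * sqn v j ^+ l * wsum lam s v ^+ (k - a)))).
  apply: (eq_Ex haar) => v _; rewrite big_enum /= /wsum big_cons addrC exprDn mulr_suml.
  by apply: eq_bigr => a _; rewrite exprMn -mulr_natl; ring.
have gterm (a : nat) : good (fun v : cvec =>
    sqn v i ^+ a * sqn v j ^+ l * wsum lam s v ^+ (k - a)).
  by apply: goodM; [apply: goodM|]; apply: goodX; (exact: good_sqn || exact: good_wsum).
rewrite (Ex_sum haar); last by move=> a; apply: goodM => //; exact: good_cst.
rewrite big_enum /= mulr_sumr mulr_suml; apply: eq_bigr => a _.
rewrite (ExZ haar) //.
have ak : (a <= k)%N by rewrite -ltnS.
have s_inv (U : op R I) (v : cvec) :
    (forall k, k != i -> k != j -> sqn (op_apply U v) k = sqn v k) ->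
    wsum lam s (op_apply U v) = wsum lam s v.
  move=> Uk; apply: eq_big_seq => k' sk'; rewrite Uk //.
    by apply: contraNneq is_ => <-.
  by apply: contraNneq js => <-.
have Hm : (a + l)`!%:R * Ex (fun v => sqn v i ^+ a * sqn v j ^+ l * wsum lam s v ^+ (k - a))
    = (a`! * l`!)%:R * Ex (fun v => sqn v j ^+ (a + l) * wsum lam s v ^+ (k - a)).
  apply: (Ex_merge haar ij); first exact/goodX/good_wsum.
    move=> t v; congr (_ ^+ _); apply: s_inv => k' ki kj.
    by rewrite /sqn rot_applyN.
  by move=> v; congr (_ ^+ _); apply: s_inv => k' _ _; exact: phase_sqn.
have IH := IHs (k - a)%N (a + l)%N us js.
have kal : (k - a + (a + l) = k + l)%N by lia.
rewrite kal in IH.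
have E2 : Ex (fun v => sqn v j ^+ (a + l) * wsum lam s v ^+ (k - a)) =
    Ex (fun v => wsum lam s v ^+ (k - a) * sqn v j ^+ (a + l)).
  by apply: (eq_Ex haar) => v _; rewrite mulrC.
move: Hm; rewrite E2 IH -(bin_fact ak) !natrM => Hm.
apply: (mulfI (fact_nz (a + l)%N)); rewrite mulrCA Hm; ring.
Qed.

(** The moment [tau] of the pivot is the one unknown left. Weights all equal to 1 determine it,
    since their [wsum] is 1 on the sphere. *)
Lemma Ex_wsum (lam : I -> R) k : (0 < #|I|)%N ->
  Ex (fun v => wsum lam (enum I) v ^+ k) * rising #|I|%:R k =
  hsym [seq lam i | i <- enum I] k.
Proof.
rewrite cardE => cI.
case eI: (enum I) cI (enum_uniq I) => [|j s] //= _ /andP[js us].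
have fact_nz n : n`!%:R != 0 :> R by rewrite pnatr_eq0 -lt0n fact_gt0.
pose tau := Ex (fun v => sqn v j ^+ k).
have step (mu : I -> R) :
    Ex (fun v => wsum mu (j :: s) v ^+ k) = hsym [seq mu i | i <- j :: s] k * tau.
  transitivity (Ex (fun v => \sum_(a <- enum 'I_k.+1) ('C(k, a)%:R * mu j ^+ a) *
      (wsum mu s v ^+ (k - a) * sqn v j ^+ a))).
    apply: (eq_Ex haar) => v _; rewrite big_enum /= /wsum big_cons addrC exprDn.
    by apply: eq_bigr => a _; rewrite exprMn -mulr_natl; ring.
  have gterm (a : nat) : good (fun v : cvec => wsum mu s v ^+ (k - a) * sqn v j ^+ a).
    by apply: goodM; apply: goodX; [exact: good_wsum | exact: good_sqn].
  rewrite (Ex_sum haar); last by move=> a; apply: goodM => //; exact: good_cst.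
  rewrite big_enum /= mulr_suml; apply: eq_bigr => a _.
  have ak : (a <= k)%N by rewrite -ltnS.
  rewrite (ExZ haar) // Ex_wsum_pivot // subnK // -/tau.
  have := fact_nz k; rewrite -(bin_fact ak) !natrM => nz.
  move: nz; rewrite !mulf_eq0 !negb_or => /and3P[n1 n2 n3].
  by field; rewrite n1 n2 n3.
have := step (fun=> 1).
rewrite (@eq_Ex _ _ _ _ _ _ haar _ (fun=> 1)); last first.
  move=> v /unitvE uv; rewrite /wsum (eq_bigr (sqn v)) => [|i _]; last exact: mul1r.
  by rewrite -eI big_enum /= uv expr1n.
rewrite Ex_cst.
have -> : [seq (fun=> 1 : R) i | i <- j :: s] = nseq (size (j :: s)) 1.
  by elim: (j :: s) => //= x r ->.
rewrite hsym_nseq1 /= => one; rewrite step -mulrA [tau * _]mulrC -one mulr1.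
by [].
Qed.

Lemma Ex_wsum_le (lam : I -> R) (S : R) k : (0 < #|I|)%N ->
  (forall i, 0 <= lam i <= 1) -> \sum_i lam i <= S ->
  Ex (fun v => wsum lam (enum I) v ^+ k) <= \prod_(a < k) ((S + a%:R) / (#|I|%:R + a%:R)).
Proof.
move=> cI lam01 lamS; have d0 : 0 < #|I|%:R :> R by rewrite ltr0n.
have r0 := rising_gt0 k d0.
rewrite -rising_ratio // ler_pdivlMr // Ex_wsum //.
have lam_all : all (fun x => 0 <= x <= 1) [seq lam i | i <- enum I].
  by apply/allP => _ /mapP[i _ ->].
have /andP[_ h] := hsym_le k lam_all; apply: le_trans h _.
rewrite big_map big_enum /=; apply: ler_prod => a _.
have s0 : 0 <= \sum_i lam i by apply: sumr_ge0 => i _; case/andP: (lam01 i).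
by rewrite divr_ge0 ?addr_ge0 //= ler_pM2r ?invr_gt0 // lerD2r.
Qed.

End HaarDiagonal.

(** * Quadratic forms and their diagonalisation *)

Section QuadraticForms.
Variables (R : realType) (I : finType).
Local Notation C := R[i].
Implicit Types (X : op R I) (v : I -> C).

Definition qform X v : C := \sum_i \sum_j (v i)^* * X i j * v j.

Definition vec2 (i j : I) (x y : C) : I -> C :=
  fun k => (k == i)%:R * x + (k == j)%:R * y.

Lemma qform_vec2 X i j x y : qform X (vec2 i j x y) =
  x^* * X i i * x + x^* * X i j * y + y^* * X j i * x + y^* * X j j * y.
Proof.
have inner k : \sum_l X k l * vec2 i j x y l = X k i * x + X k j * y.
  rewrite /vec2; under eq_bigr do rewrite mulrDr !(mulrCA (X k _)).
  by rewrite big_split /= !sum_delta.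
rewrite /qform; under eq_bigr do under eq_bigr do rewrite -mulrA.
under eq_bigr do rewrite -mulr_sumr inner /vec2 rmorphD !rmorphM !rmorph_nat mulrDl -!mulrA.
by rewrite big_split /= !sum_delta; ring.
Qed.

Lemma psd_diag_ge0 X i : psd X -> 0 <= X i i.
Proof.
move=> /(_ (vec2 i i 1 0)); rewrite -/(qform _ _) qform_vec2.
by rewrite rmorph1 rmorph0 !(mul0r, mulr0, mul1r, mulr1, addr0).
Qed.

(** Being nonnegative in [R[i]] includes being real. The test vectors [(1, 1)] and [(1, i)] yield
    the imaginary and the real part of the claim. *)
Lemma psd_herm X i j : psd X -> X j i = (X i j)^*.
Proof.
move=> pX.
have h1 := ger0_Im (pX (vec2 i j 1 1)).
have h2 := ger0_Im (pX (vec2 i j 1 'i%C)).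
have pi := ger0_Im (psd_diag_ge0 i pX); have pj := ger0_Im (psd_diag_ge0 j pX).
move: h1 h2; rewrite -!/(qform _ _) !qform_vec2.
move: (X i i) (X j j) (X i j) (X j i) pi pj => [p p'] [q q'] [a a'] [b b'] /= -> -> h1 h2.
by apply/eqP; rewrite eq_complex /=; apply/andP; split; apply/eqP; lra.
Qed.

Lemma spectral_psd X : psd X -> exists (U : op R I) (D : I -> C),
  [/\ unitary U, forall k l, \sum_i U k i * (U l i)^* = (k == l)%:R &
      forall i j, X i j = \sum_k (U k i)^* * D k * U k j].
Proof.
move=> pX; pose A : 'M[C]_#|I| := \matrix_(a, b) X (enum_val a) (enum_val b).
have AT : map_mx Num.conj A^T = A.
  by apply/matrixP => a b; rewrite !mxE -psd_herm.
have /orthomx_spectralP : A \is normalmx by apply/normalmxP; rewrite AT.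
have := spectral_unitarymx A.
move: (spectralmx A) (spectral_diag A) => P D uP; rewrite invmx_unitary // => AE.
have PP := unitarymxP uP.
have PP' := mulmx1C PP.
have rk (F : 'I_#|I| -> C) : \sum_(i : I) F (enum_rank i) = \sum_a F a.
  by rewrite (reindex (@enum_rank I)) //; apply: onW_bij; exact: enum_rank_bij.
exists (fun i j => P (enum_rank i) (enum_rank j)), (fun i => D 0 (enum_rank i)); split.
- move=> i j; rewrite (rk (fun a => (P a (enum_rank i))^* * P a (enum_rank j))).
  have /matrixP/(_ (enum_rank i) (enum_rank j)) := PP'.
  rewrite !mxE (inj_eq enum_rank_inj) => <-.
  by apply: eq_bigr => a _; rewrite !mxE.
- move=> k l; rewrite (rk (fun a => P (enum_rank k) a * (P (enum_rank l) a)^*)).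
  have /matrixP/(_ (enum_rank k) (enum_rank l)) := PP.
  rewrite !mxE (inj_eq enum_rank_inj) => <-.
  by apply: eq_bigr => a _; rewrite !mxE.
- move=> i j; rewrite (rk (fun a => (P a (enum_rank i))^* * D 0 a * P a (enum_rank j))).
  have /matrixP/(_ (enum_rank i) (enum_rank j)) := AE.
  rewrite !mxE !enum_rankK => ->; apply: eq_bigr => a _.
  by rewrite mul_mx_diag !mxE.
Qed.

Lemma good_re_qform X : good (fun v => complex.Re (qform X v)).
Proof.
have -> : (fun v => complex.Re (qform X v)) = (fun v => \sum_i \sum_j
    (complex.Re (X i j) * (complex.Re (v i) * complex.Re (v j) + complex.Im (v i) * complex.Im (v j))
   - complex.Im (X i j) * (complex.Re (v i) * complex.Im (v j) - complex.Im (v i) * complex.Re (v j)))).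
  apply/funext => v; rewrite /qform (raddf_sum (@complex.Re R)).
  apply: eq_bigr => i _; rewrite (raddf_sum (@complex.Re R)); apply: eq_bigr => j _.
  by case: (X i j) => a b; case: (v i) => c d; case: (v j) => e f /=; ring.
have gr := @good_re R I; have gi := @good_im R I; have gc := @good_cst R I.
apply: good_sum => i; apply: good_sum => j.
by apply: goodB; (apply: goodM => //); [apply: goodD|apply: goodB]; exact: goodM.
Qed.

(** In an eigenbasis the form is the [wsum] of its eigenvalues, and Haar invariance removes the
    change of basis. *)
Lemma Ex_qform_le (dsp : measure_display) (Omega : measurableType dsp)
    (P : probability Omega R) (psi : Omega -> I -> C) X (S : R) k :
  haar_random P psi -> (0 < #|I|)%N -> psd X ->
  (forall v, unitv v -> qform X v <= 1) -> complex.Re (trace X) <= S ->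
  Ex P psi (fun v => complex.Re (qform X v) ^+ k) <=
    \prod_(a < k) ((S + a%:R) / (#|I|%:R + a%:R)).
Proof.
move=> haar cI pX X1 trS.
have [U [D [uU uU' XE]]] := spectral_psd pX.
have qE v : qform X v = \sum_k D k * (sqn (op_apply U v) k)%:C%C.
  transitivity (\sum_i \sum_j \sum_k D k * (((U k i)^* * (v i)^*) * (U k j * v j))).
    apply: eq_bigr => i _; apply: eq_bigr => j _.
    rewrite XE mulr_sumr mulr_suml; apply: eq_bigr => k' _; ring.
  under eq_bigr do rewrite exchange_big.
  rewrite exchange_big /=; apply: eq_bigr => k' _.
  rewrite -sqnE normCK /op_apply [X in _ = _ * X]mulrC rmorph_sum mulr_suml mulr_sumr.
  apply: eq_bigr => i _; rewrite mulr_sumr mulr_sumr; apply: eq_bigr => j _.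
  by rewrite rmorphM; ring.
(* Each eigenvalue is the value of the form at a unit eigenvector, the conjugated row [k'] of
   [U]. *)
have D01 k' : 0 <= D k' <= 1.
  pose v i := (U k' i)^*.
  have Uv l : op_apply U v l = (l == k')%:R by rewrite /op_apply /v uU'.
  have uv : unitv v.
    have := uU' k' k'; rewrite eqxx mulr1n /unitv => <-.
    by apply: eq_bigr => i _; rewrite /v normCK conjCK mulrC.
  suff -> : D k' = qform X v by rewrite pX X1.
  rewrite qE (bigD1 k') //= big1 ?addr0 => [|l /negPf lk].
    by rewrite -sqnE Uv eqxx normr1 expr1n mulr1.
  by rewrite -sqnE Uv lk normr0 expr0n mulr0.
pose lam i := complex.Re (D i).
have DE i : D i = (lam i)%:C%C.
  by rewrite /lam RRe_real // ger0_real //; case/andP: (D01 i).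
have lam01 i : 0 <= lam i <= 1.
  by have := D01 i; rewrite DE -(rmorph1 (real_complex R)) -(rmorph0 (real_complex R)) !lecR.
have lamS : \sum_i lam i <= S.
  apply: le_trans trS; rewrite /trace.
  have -> : \sum_i X i i = \sum_i D i; last first.
    by rewrite (raddf_sum (@complex.Re R)).
  under eq_bigr do rewrite XE.
  rewrite exchange_big /=; apply: eq_bigr => k' _.
  transitivity (\sum_i D k' * (U k' i * (U k' i)^*)); first by apply: eq_bigr => i _; ring.
  by rewrite -mulr_sumr uU' eqxx mulr1.
have := Ex_wsum_le haar k cI lam01 lamS; apply: le_trans.
rewrite le_eqVlt; apply/orP; left; apply/eqP.
rewrite -[RHS](Ex_op_apply haar uU); last exact/goodX/good_wsum.
apply: (eq_Ex haar) => v _ /=; congr (_ ^+ _).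
rewrite qE /wsum big_enum /= (raddf_sum (@complex.Re R)).
by apply: eq_bigr => i _; rewrite DE -rmorphM.
Qed.

End QuadraticForms.

(** * Positive semidefinite operators and channels *)

Section PsdEntries.
Variables (R : realType).
Local Notation C := R[i].
Implicit Types I J K : finType.

Lemma le_half_sum (a b z : C) : 0 <= a -> 0 <= b -> 0 <= z -> z ^+ 2 <= a * b ->
  z <= (a + b) / 2.
Proof.
move=> a0 b0 z0 zab; rewrite -(@ler_pXn2r _ 2) ?nnegrE ?divr_ge0 ?addr_ge0 //.
apply: le_trans zab _; rewrite -subr_ge0.
have -> : ((a + b) / 2) ^+ 2 - a * b = ((a - b) / 2) ^+ 2 by field.
by rewrite real_exprn_even_ge0 // realM ?realB ?ger0_real // invr_ge0.
Qed.

(** A nonnegative 2 by 2 minor: on the vectors [(s, - t conj z)] the form is a real quadratic form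
    in [s] and [t], evaluated at [(q, 1)]. *)
Lemma psd_normX2 I (X : op R I) i j : psd X -> `|X i j| ^+ 2 <= X i i * X j j.
Proof.
move=> pX; have p0 := psd_diag_ge0 i pX; have q0 := psd_diag_ge0 j pX.
set z := X i j; have zz : z * z^* = `|z| ^+ 2 by rewrite normCK.
have quad (s t : R) :
    0 <= s%:C%C ^+ 2 * X i i + t%:C%C ^+ 2 * `|z| ^+ 2 * X j j - 2 * s%:C%C * t%:C%C * `|z| ^+ 2.
  have := pX (vec2 i j s%:C%C (- (z^*) * t%:C%C)).
  rewrite -/(qform _ _) qform_vec2 (psd_herm i j pX) -/z -zz.
  have cR (x : R) : (x%:C%C)^* = x%:C%C by exact: conjc_real.
  have -> : (- z^* * t%:C%C)^* = - z * t%:C%C.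
    have cM (x y : C) : (x * y)^* = x^* * y^* by exact: rmorphM.
    have cN (x : C) : (- x)^* = - x^* by exact: rmorphN.
    by rewrite cM cN cR conjCK.
  rewrite cR.
  by congr (_ <= _); ring.
have [p pE] : exists p : R, X i i = p%:C%C by apply/complex_realP/ger0_real.
have [q qE] : exists q : R, X j j = q%:C%C by apply/complex_realP/ger0_real.
have [n nE] : exists n : R, `|z| ^+ 2 = n%:C%C.
  by apply/complex_realP/ger0_real; rewrite exprn_ge0.
have n0 : 0 <= n by rewrite -lecR -nE exprn_ge0.
rewrite pE qE -rmorphM nE lecR; rewrite qE lecR in q0; rewrite pE lecR in p0.
have {}quad s t : 0 <= s ^+ 2 * p + t ^+ 2 * n * q - 2 * s * t * n.
  have := quad s t; rewrite pE qE nE -!rmorphXn -[2]/(2%:R) -(rmorph_nat (real_complex R) 2).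
  by rewrite -!rmorphM -rmorphD -rmorphB lecR.
have [q00|qn0] := eqVneq q 0.
  rewrite q00 mulr0; rewrite leNgt; apply/negP => n1.
  (* For [q = 0] the form is affine in [t], and this [t] gives it the value [-1]. *)
  have := quad 1 ((p + 1) / (2 * n)); rewrite q00 mulr0 addr0 expr1n mul1r mulr1.
  by rewrite (_ : 2 * ((p + 1) / (2 * n)) * n = p + 1); [lra | field; rewrite gt_eqF].
have q1 : 0 < q by rewrite lt_def qn0.
have := quad q 1.
have -> : q ^+ 2 * p + 1 ^+ 2 * n * q - 2 * q * 1 * n = q * (p * q - n) by ring.
by rewrite pmulr_rge0 // subr_ge0.
Qed.
End PsdEntries.

Section Channels.
Variables (R : realType).
Local Notation C := R[i].
Implicit Types I J K : finType.

Lemma psd_norm_le I (X : op R I) i j : psd X -> `|X i j| <= (X i i + X j j) / 2.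
Proof.
move=> pX; apply: le_half_sum; rewrite ?normr_ge0 ?psd_diag_ge0 //.
exact: psd_normX2.
Qed.

Lemma psd_diag_le_trace I (X : op R I) i : psd X -> X i i <= trace X.
Proof.
move=> pX; rewrite /trace (bigD1 i) //= lerDl.
by apply: sumr_ge0 => j _; exact: psd_diag_ge0.
Qed.

Lemma psd_norm_le_trace I (X : op R I) i j : psd X -> `|X i j| <= trace X.
Proof.
move=> pX; apply: le_trans (psd_norm_le i j pX) _.
rewrite ler_pdivrMr ?ltr0n // mulr_natr mulr2n.
by rewrite lerD // psd_diag_le_trace.
Qed.

(** By [psd_normX2] and the inequality of means, [|X_ij Y_ij|] is at most the mean of [X_ii Y_jj]
    and [X_jj Y_ii]; this pairing produces the product of the traces. It is the source of the bound
    on [tr M]. *)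
Lemma psd_hadamard_trace I (X Y : op R I) : psd X -> psd Y ->
  \sum_i \sum_j `|X i j * Y i j| <= trace X * trace Y.
Proof.
move=> pX pY.
apply: (@le_trans _ _ (\sum_i \sum_j (X i i * Y j j + X j j * Y i i) / 2)).
  apply: ler_sum => i _; apply: ler_sum => j _; apply: le_half_sum.
  - by rewrite mulr_ge0 ?psd_diag_ge0.
  - by rewrite mulr_ge0 ?psd_diag_ge0.
  - exact: normr_ge0.
  rewrite normrM exprMn mulrACA [X in _ <= _ * X]mulrC -mulrACA.
  rewrite [X in _ <= X](_ : _ = (X i i * X j j) * (Y i i * Y j j)); last by ring.
  by apply: ler_pM; rewrite ?exprn_ge0 ?psd_normX2.
have e : \sum_i \sum_j X i i * Y j j = trace X * trace Y.
  by rewrite /trace mulr_suml; apply: eq_bigr => i _; rewrite mulr_sumr.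
have e' : \sum_i \sum_j X j j * Y i i = trace X * trace Y by rewrite exchange_big.
rewrite le_eqVlt; apply/orP; left; apply/eqP.
under eq_bigr do rewrite -mulr_suml big_split.
by rewrite -mulr_suml big_split /= e e' -mulr2n -[_ *+ 2]mulr_natr mulfK // pnatr_eq0.
Qed.

(** A congruence by the 0/1 matrix of [f], which may repeat or omit indices: it covers relabelling,
    swapping of tensor factors and restriction to indices [(x, x)]. *)
Lemma psd_comp I J (f : J -> I) (X : op R I) : psd X ->
  psd (fun a b => X (f a) (f b)).
Proof.
move=> pX v; pose w i := \sum_a (f a == i)%:R * v a.
have inner i : \sum_b X i (f b) * v b = \sum_j X i j * w j.
  rewrite /w; under [RHS]eq_bigr do rewrite mulr_sumr.
  rewrite exchange_big /=; apply: eq_bigr => b _.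
  rewrite -(sum_delta (f b) (fun j => X i j * v b)); apply: eq_bigr => j _.
  by rewrite eq_sym; ring.
have := pX w; congr (_ <= _); symmetry.
under eq_bigr do under eq_bigr do rewrite -mulrA.
under eq_bigr do rewrite -mulr_sumr inner.
under [RHS]eq_bigr do under eq_bigr do rewrite -mulrA.
under [RHS]eq_bigr do rewrite -mulr_sumr {1}/w rmorph_sum mulr_suml.
rewrite [RHS]exchange_big /=; apply: eq_bigr => a _.
rewrite -(sum_delta (f a) (fun i => (v a)^* * \sum_j X i j * w j)).
apply: eq_bigr => i _; rewrite [((_ == i)%:R * _)^*]rmorphM rmorph_nat eq_sym /=.
by rewrite mulrA.
Qed.

Lemma psd_rank1 I (w : I -> C) : psd (fun i j => w i * (w j)^*).
Proof.
move=> v; have -> : \sum_i \sum_j (v i)^* * (w i * (w j)^*) * v j =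
    `|\sum_j (w j)^* * v j| ^+ 2.
  rewrite normCK mulrC rmorph_sum /= mulr_suml; apply: eq_bigr => i _.
  rewrite mulr_sumr; apply: eq_bigr => j _.
  have -> : ((w i)^* * v i)^* = w i * (v i)^* by rewrite [LHS]rmorphM /= conjCK.
  ring.
exact: exprn_ge0.
Qed.

Lemma psd_sum I (T : Type) (r : seq T) (X : T -> op R I) :
  (forall t, psd (X t)) -> psd (fun i j => \sum_(t <- r) X t i j).
Proof.
move=> pX v; have -> : \sum_i \sum_j (v i)^* * (\sum_(t <- r) X t i j) * v j =
    \sum_(t <- r) qform (X t) v.
  rewrite /qform [RHS]exchange_big /=; apply: eq_bigr => i _; rewrite [RHS]exchange_big /=.
  by apply: eq_bigr => j _; rewrite mulr_sumr mulr_suml.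
by apply: sumr_ge0 => t _; exact: pX.
Qed.

(** Transfers complete positivity from the ancillas ['I_k] of its definition to any finite type. *)
Lemma cp_ampl I J K (Phi : op R I -> op R J) (X : op R (K * I)%type) :
  completely_positive Phi -> psd X ->
  psd (fun p q : K * J => Phi (fun i i' => X (p.1, i) (q.1, i')) p.2 q.2).
Proof.
move=> cP pX.
pose f (p : 'I_#|K| * I) : K * I := (enum_val p.1, p.2).
pose g (p : K * J) : 'I_#|K| * J := (enum_rank p.1, p.2).
have := psd_comp g (cP _ _ (psd_comp f pX)).
congr psd; apply/funext => -[k j]; apply/funext => -[k' j'] /=.
rewrite /ampl /=; congr (Phi _ _ _); apply/funext => i; apply/funext => i'.
by rewrite /f /= !enum_rankK.
Qed.

Definition munit I (t : I * I) : op R I := fun i i' => ((i == t.1) && (i' == t.2))%:R.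

Definition choi I J (Phi : op R I -> op R J) (t : I * I) : op R J := Phi (munit t).

Lemma op_linearE I J (Phi : op R I -> op R J) X x y : op_linear Phi ->
  Phi X x y = \sum_(t : I * I) X t.1 t.2 * choi Phi t x y.
Proof.
move=> lin.
have lin0 : Phi (fun _ _ => 0) x y = 0.
  have := lin 1 (fun _ _ => 0) (fun _ _ => 0) x y.
  have -> : (fun k l : I => 1 * 0 + 0 : C) = (fun _ _ => 0).
    by apply/funext => k; apply/funext => l; rewrite mulr0 addr0.
  by rewrite mul1r => /eqP; rewrite -subr_eq0 opprD addNKr oppr_eq0 => /eqP.
have lin_sum (r : seq (I * I)) :
    Phi (fun k l => \sum_(t <- r) X t.1 t.2 * munit t k l) x y
    = \sum_(t <- r) X t.1 t.2 * choi Phi t x y.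
  elim: r => [|t r IHr].
    rewrite big_nil -[RHS]lin0; congr (Phi _ x y).
    by apply/funext => k; apply/funext => l; rewrite big_nil.
  rewrite big_cons -IHr -lin; congr (Phi _ x y).
  by apply/funext => k; apply/funext => l; rewrite big_cons.
rewrite -lin_sum; congr (Phi _ x y); apply/funext => k; apply/funext => l.
rewrite (bigD1 (k, l)) //= /munit /= !eqxx mulr1 big1 ?addr0 // => -[k' l'].
rewrite xpair_eqE negb_and /= => /orP[] /negPf; rewrite eq_sym => ->.
  by rewrite mulr0.
by rewrite andbF mulr0.
Qed.

(** The Choi matrix is the image of the unnormalised maximally entangled projector, which has rank
    1. *)
Lemma psd_choi I J (Phi : op R I -> op R J) : completely_positive Phi ->
  psd (fun p q : I * J => choi Phi (p.1, q.1) p.2 q.2).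
Proof.
move=> cP; have := cp_ampl cP (psd_rank1 (fun p : I * I => (p.2 == p.1)%:R)).
congr psd; apply/funext => p; apply/funext => q; rewrite /choi; congr (Phi _ _ _).
apply/funext => k; apply/funext => l; rewrite /munit /=.
by rewrite [(_ %:R)^*]rmorph_nat -natrM mulnb.
Qed.

Lemma trace_choi I J (Phi : op R I -> op R J) i : channel Phi -> trace (choi Phi (i, i)) = 1.
Proof.
move=> [_ _ tP]; rewrite tP /trace /munit /=.
by rewrite (bigD1 i) //= !eqxx big1 ?addr0 // => k /negPf ->.
Qed.

(** The Choi matrix is positive with trace [|I|]. This uniform bound makes the determinants of the
    interpolation bounded and the set of channels compact. *)
Lemma choi_bound I J (Phi : op R I -> op R J) t x y : channel Phi ->
  `|choi Phi t x y| <= #|I|%:R.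
Proof.
move=> cP; have [_ pP _] := cP.
have := psd_norm_le_trace (t.1, x) (t.2, y) (psd_choi pP).
rewrite -surjective_pairing; congr (_ <= _); rewrite /trace.
transitivity (\sum_i \sum_j choi Phi (i, i) j j).
  by rewrite pair_bigA; apply: eq_bigr => -[].
rewrite -sum1_card natr_sum; apply: eq_bigr => i _; exact: trace_choi.
Qed.

End Channels.

(** * Local operations and the EPR fidelity *)

Section LocalOperations.
Variables (R : realType).
Local Notation C := R[i].
Implicit Types I J K : finType.

Lemma sum_prodT (A B : finType) (F : A * B -> C) :
  \sum_p F p = \sum_a \sum_b F (a, b).
Proof. by rewrite pair_bigA; apply: eq_bigr => -[]. Qed.

(** The sum is the form at the all-ones vector, of squared norm [|I|]. *)
Lemma psd_sum_entries I (Z : op R I) : psd Z ->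
  0 <= \sum_a \sum_b Z a b <= #|I|%:R * trace Z.
Proof.
move=> pZ; have ge0 : 0 <= \sum_a \sum_b Z a b.
  have := pZ (fun=> 1); congr (_ <= _); apply: eq_bigr => a _.
  by apply: eq_bigr => b _; rewrite [1^*]rmorph1 mul1r mulr1.
rewrite ge0 /= -(ger0_norm ge0).
apply: (@le_trans _ _ (\sum_a \sum_b (Z a a + Z b b) / 2)).
  apply: le_trans (ler_norm_sum _ _ _) _; apply: ler_sum => a _.
  apply: le_trans (ler_norm_sum _ _ _) _; apply: ler_sum => b _.
  exact: psd_norm_le.
rewrite le_eqVlt; apply/orP; left; apply/eqP.
under eq_bigr do rewrite -mulr_suml big_split /= sumr_const -/(trace Z).
rewrite -mulr_suml big_split /= sumr_const -sumrMnl -/(trace Z) -mulr2n.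
rewrite -[_ *+ 2]mulr_natr mulfK ?pnatr_eq0 //.
by rewrite mulr_natl /trace sumrMnl.
Qed.

Lemma op_linear_sum I J (Phi : op R I -> op R J) (T : finType) (Y : T -> op R I) x y :
  op_linear Phi ->
  Phi (fun k l => \sum_t Y t k l) x y = \sum_t Phi (Y t) x y.
Proof.
move=> lin; rewrite op_linearE //.
under [RHS]eq_bigr do rewrite (op_linearE _ _ _ lin).
by rewrite [RHS]exchange_big /=; apply: eq_bigr => t _; rewrite mulr_suml.
Qed.

Definition tens IA IB JA JB (PhiA : op R IA -> op R JA) (PhiB : op R IB -> op R JB)
    (rho : op R (IA * IB)%type) : op R (JA * JB)%type :=
  fun p q => PhiA (fun a a' => PhiB (fun b b' => rho (a, b) (a', b')) p.2 q.2) p.1 q.1.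

(** The two channels act one after the other, each as an ampliation; swaps of the tensor factors
    bring the active one into second place. *)
Lemma psd_tens IA IB JA JB (PhiA : op R IA -> op R JA) (PhiB : op R IB -> op R JB) rho :
  channel PhiA -> channel PhiB -> psd rho -> psd (tens PhiA PhiB rho).
Proof.
move=> [_ cA _] [_ cB _] prho.
have h1 := cp_ampl cB prho.
have h2 := psd_comp (fun p : JB * IA => (p.2, p.1)) h1.
have := psd_comp (fun p : JA * JB => (p.2, p.1)) (cp_ampl cA h2).
by congr psd; apply/funext => -[x y]; apply/funext => -[x' y'].
Qed.

Lemma trace_tens IA IB JA JB (PhiA : op R IA -> op R JA) (PhiB : op R IB -> op R JB) rho :
  channel PhiA -> channel PhiB -> trace (tens PhiA PhiB rho) = trace rho.
Proof.
move=> [_ _ tA] [_ _ tB]; rewrite /trace /tens.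
rewrite sum_prodT exchange_big /=.
under eq_bigr => y _ do
  rewrite -/(trace (PhiA (fun a a' => PhiB (fun b b' => rho (a, b) (a', b')) y y))) tA /trace.
rewrite exchange_big /= sum_prodT.
by apply: eq_bigr => a _; exact: (tB (fun b b' => rho (a, b) (a, b'))).
Qed.

Definition ptr (IA IB IC : finType) (psi : IA * IB * IC -> C) : op R (IA * IB)%type :=
  fun p q => \sum_c psi (p.1, p.2, c) * (psi (q.1, q.2, c))^*.

Lemma psd_ptr (IA IB IC : finType) (psi : IA * IB * IC -> C) : psd (ptr psi).
Proof.
by apply: psd_sum => c; exact: (psd_rank1 (fun p => psi (p.1, p.2, c))).
Qed.

Lemma trace_ptr (IA IB IC : finType) (psi : IA * IB * IC -> C) :
  trace (ptr psi) = \sum_i `|psi i| ^+ 2.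
Proof.
rewrite /trace /ptr pair_bigA /=; apply: eq_bigr => -[[a b] c] _ /=.
by rewrite normCK.
Qed.

(** The expectation of [Y] in the maximally entangled state on [J * J]; for [m] qubits this state is
    [EPRm]. *)
Definition epr J (Y : op R (J * J)%type) : C :=
  #|J|%:R^-1 * \sum_x \sum_y Y (x, x) (y, y).

Lemma epr_bounds J (Y : op R (J * J)%type) : (0 < #|J|)%N -> psd Y ->
  0 <= epr Y <= trace Y.
Proof.
move=> J0 pY; have := psd_sum_entries (psd_comp (fun x : J => (x, x)) pY).
case/andP=> h0 h1; have n0 : 0 < #|J|%:R :> C by rewrite ltr0n.
rewrite /epr mulr_ge0 ?invr_ge0 ?ler0n //= ler_pdivrMl //.
apply: le_trans h1 _; rewrite ler_pM2l // /trace.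
rewrite sum_prodT; apply: ler_sum => x _.
rewrite (bigD1 x) //= lerDl; apply: sumr_ge0 => y _; exact: psd_diag_ge0.
Qed.

Definition fid (IA IB IC J : finType) (PhiA : op R IA -> op R J) (PhiB : op R IB -> op R J)
  (psi : IA * IB * IC -> C) : C := epr (tens PhiA PhiB (ptr psi)).

Lemma fid_bounds (IA IB IC J : finType) (PhiA : op R IA -> op R J) (PhiB : op R IB -> op R J)
    (psi : IA * IB * IC -> C) : (0 < #|J|)%N -> channel PhiA -> channel PhiB ->
  0 <= fid PhiA PhiB psi <= \sum_i `|psi i| ^+ 2.
Proof.
move=> J0 cA cB; rewrite -trace_ptr -(trace_tens _ cA cB); apply: epr_bounds => //.
by apply: psd_tens => //; exact: psd_ptr.
Qed.

Section PartialTrace.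
Variables (J1 J2 J : finType) (e : J1 * J2 -> J).
Hypothesis be : bijective e.

Definition marg I (Phi : op R I -> op R J) : op R I -> op R J1 :=
  fun X z z' => \sum_a Phi X (e (z, a)) (e (z', a)).

Lemma channel_marg I (Phi : op R I -> op R J) : channel Phi -> channel (marg Phi).
Proof.
move=> [lin cP tP]; split.
- move=> a X Y i j; rewrite /marg mulr_sumr -big_split /=.
  by apply: eq_bigr => b _; exact: lin.
- move=> k X pX.
  have -> : ampl (marg Phi) X = (fun p q => \sum_a (fun p q : 'I_k * J1 =>
      ampl Phi X (p.1, e (p.2, a)) (q.1, e (q.2, a))) p q).
    by apply/funext => -[? ?]; apply/funext => -[? ?].
  apply: psd_sum => a; exact: (psd_comp (fun p : 'I_k * J1 => (p.1, e (p.2, a))) (cP _ _ pX)).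
- move=> X; rewrite -tP /trace /marg pair_bigA /= (reindex e); last exact: onW_bij.
  by apply: eq_bigr => -[].
Qed.

(** The maximally entangled projector on [J1 * J2] is below the one on [J1] tensored with the
    identity. Here the entries of [Z] sum to at most [|J2| tr Z], and [tr Z] collects the terms of
    the right side where both parties trace out the same [a]; its other terms are nonnegative. *)
Lemma epr_marg IA IB (PhiA : op R IA -> op R J) (PhiB : op R IB -> op R J) rho :
  (0 < #|J1|)%N -> (0 < #|J2|)%N ->
  channel PhiA -> channel PhiB -> psd rho ->
  epr (tens PhiA PhiB rho) <= epr (tens (marg PhiA) (marg PhiB) rho).
Proof.
move=> J10 J20 cA cB prho; pose Y := tens PhiA PhiB rho.
have pY : psd Y by exact: psd_tens.
have n1 : 0 < #|J1|%:R :> C by rewrite ltr0n.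
have n2 : 0 < #|J2|%:R :> C by rewrite ltr0n.
have mE p q : tens (marg PhiA) (marg PhiB) rho p q =
    \sum_a \sum_b Y (e (p.1, a), e (p.2, b)) (e (q.1, a), e (q.2, b)).
  rewrite /tens /marg; apply: eq_bigr => a _.
  by rewrite op_linear_sum; case: cA.
pose S (f : J1 -> J * J) : C := \sum_z \sum_z' Y (f z) (f z').
have S_ge0 (f : J1 -> J * J) : 0 <= S f by case/andP: (psd_sum_entries (psd_comp f pY)).
pose d (p : J1 * J2) := (e p, e p).
pose Z a b := \sum_z \sum_z' Y (d (z, a)) (d (z', b)).
have pZ : psd Z.
  move=> v; have := psd_comp d pY (fun p => v p.2); congr (_ <= _).
  rewrite sum_prodT exchange_big /=; apply: eq_bigr => a _.
  transitivity (\sum_z \sum_z' \sum_b (v a)^* * Y (d (z, a)) (d (z', b)) * v b).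
    by apply: eq_bigr => z _; rewrite sum_prodT.
  transitivity (\sum_z \sum_b \sum_z' (v a)^* * Y (d (z, a)) (d (z', b)) * v b).
    by apply: eq_bigr => z _; rewrite exchange_big.
  rewrite exchange_big /=; apply: eq_bigr => b _.
  rewrite /Z mulr_sumr mulr_suml; apply: eq_bigr => z _.
  by rewrite mulr_sumr mulr_suml.
have cJ : #|J| = (#|J1| * #|J2|)%N by rewrite -card_prod (bij_eq_card be).
have lhs : epr Y = #|J1|%:R^-1 * (#|J2|%:R^-1 * \sum_a \sum_b Z a b).
  rewrite /epr cJ natrM invfM -mulrA; congr (_ * (_ * _)).
  rewrite (reindex e) /=; last exact: onW_bij.
  transitivity (\sum_p \sum_q Y (d p) (d q)).
    apply: eq_bigr => p _; rewrite (reindex e) //; exact: onW_bij.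
  rewrite sum_prodT exchange_big /=.
  apply: eq_bigr => a _; rewrite /Z [RHS]exchange_big /=; apply: eq_bigr => z _.
  by rewrite sum_prodT exchange_big.
have rhs : epr (tens (marg PhiA) (marg PhiB) rho) =
    #|J1|%:R^-1 * \sum_a \sum_b S (fun z => (e (z, a), e (z, b))).
  rewrite /epr; congr (_ * _).
  transitivity (\sum_z \sum_z' \sum_a \sum_b Y (e (z, a), e (z, b)) (e (z', a), e (z', b))).
    by apply: eq_bigr => z _; apply: eq_bigr => z' _; rewrite mE.
  rewrite /S; under eq_bigr do rewrite exchange_big /=.
  rewrite exchange_big /=; apply: eq_bigr => a _.
  under eq_bigr do rewrite exchange_big /=.
  by rewrite exchange_big.
rewrite -/Y lhs rhs ler_pM2l ?invr_gt0 // ler_pdivrMl //.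
have /andP[_ hZ] := psd_sum_entries pZ; apply: le_trans hZ _; rewrite ler_pM2l //.
apply: ler_sum => a _; rewrite (bigD1 a) //= -/(S _) lerDl.
by apply: sumr_ge0 => b _; exact: S_ge0.
Qed.

End PartialTrace.

Definition kern IA IB J (PhiA : op R IA -> op R J) (PhiB : op R IB -> op R J) s t : C :=
  #|J|%:R^-1 * \sum_x \sum_y choi PhiA s x y * choi PhiB t x y.

Lemma fid_kern (IA IB IC J : finType) (PhiA : op R IA -> op R J) (PhiB : op R IB -> op R J)
    (psi : IA * IB * IC -> C) : op_linear PhiA -> op_linear PhiB ->
  fid PhiA PhiB psi =
  \sum_s \sum_t kern PhiA PhiB s t * ptr psi (s.1, t.1) (s.2, t.2).
Proof.
move=> lA lB; rewrite /fid /epr.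
transitivity (#|J|%:R^-1 * \sum_x \sum_y \sum_s \sum_t
    (choi PhiA s x y * choi PhiB t x y * ptr psi (s.1, t.1) (s.2, t.2))).
  congr (_ * _); apply: eq_bigr => x _; apply: eq_bigr => y _.
  rewrite /tens /= op_linearE //; apply: eq_bigr => s _.
  rewrite op_linearE // mulr_suml; apply: eq_bigr => t _; ring.
transitivity (#|J|%:R^-1 * \sum_s \sum_t \sum_x \sum_y
    (choi PhiA s x y * choi PhiB t x y * ptr psi (s.1, t.1) (s.2, t.2))); last first.
  rewrite mulr_sumr; apply: eq_bigr => s _; rewrite mulr_sumr; apply: eq_bigr => t _.
  rewrite /kern -mulrA; congr (_ * _); rewrite mulr_suml; apply: eq_bigr => x _.
  by rewrite mulr_suml.
congr (_ * _); under eq_bigr do rewrite exchange_big /=.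
rewrite exchange_big /=; apply: eq_bigr => s _.
by under eq_bigr do rewrite exchange_big /=; rewrite exchange_big.
Qed.

(** [M] is the adjoint channel at the EPR projector, tensored with the identity of [C]; it is
    positive because its form is a fidelity. Its trace pairs the images [A] and [B] of the two
    identity operators, of traces [|IA|] and [|IB|], entry by entry, so [psd_hadamard_trace] applies
    and the factor [1 / |J|] remains. *)
Lemma fid_op (IA IB IC J : finType) (PhiA : op R IA -> op R J) (PhiB : op R IB -> op R J) :
  (0 < #|J|)%N -> channel PhiA -> channel PhiB ->
  exists M : op R (IA * IB * IC)%type,
    [/\ psd M, forall psi, qform M psi = fid PhiA PhiB psi &
        `|trace M| <= #|IC|%:R * (#|IA|%:R * #|IB|%:R) / #|J|%:R].
Proof.
move=> J0 cA cB; have [lA pA _] := cA; have [lB pB _] := cB.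
pose k a a' b b' := kern PhiA PhiB (a, a') (b, b').
pose M : op R (IA * IB * IC)%type := fun q p =>
  (p.2 == q.2)%:R * k p.1.1 q.1.1 p.1.2 q.1.2.
have qM psi : qform M psi = fid PhiA PhiB psi.
  rewrite fid_kern //; pose G a a' b b' c :=
    k a a' b b' * (psi (a, b, c) * (psi (a', b', c))^*).
  transitivity (\sum_a' \sum_b' \sum_c \sum_a \sum_b G a a' b b' c).
    rewrite /qform !sum_prodT; apply: eq_bigr => a' _; apply: eq_bigr => b' _.
    apply: eq_bigr => c _; rewrite !sum_prodT; apply: eq_bigr => a _; apply: eq_bigr => b _.
    rewrite /G -(sum_delta c (fun c' => k a a' b b' * (psi (a, b, c') * (psi (a', b', c))^* ))).
    apply: eq_bigr => c' _; rewrite /M /=; ring.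
  transitivity (\sum_a \sum_a' \sum_b \sum_b' \sum_c G a a' b b' c); last first.
    rewrite sum_prodT; apply: eq_bigr => a _; apply: eq_bigr => a' _.
    rewrite sum_prodT; apply: eq_bigr => b _; apply: eq_bigr => b' _.
    by rewrite /ptr mulr_sumr.
  rewrite [RHS]exchange_big /=; apply: eq_bigr => a' _.
  under eq_bigr do rewrite exchange_big /=.
  rewrite exchange_big /=; apply: eq_bigr => a _.
  under eq_bigr do rewrite exchange_big /=.
  by rewrite exchange_big.
exists M; split => //.
  by move=> v; rewrite -/(qform M v) qM; case/andP: (fid_bounds v J0 cA cB).
pose A (x y : J) := \sum_a choi PhiA (a, a) x y; pose B (x y : J) := \sum_b choi PhiB (b, b) x y.
have psdA : psd A.
  by apply: psd_sum => a; exact: (psd_comp (fun x => (a, x)) (psd_choi pA)).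
have psdB : psd B.
  by apply: psd_sum => b; exact: (psd_comp (fun x => (b, x)) (psd_choi pB)).
have trA : trace A = #|IA|%:R.
  rewrite /trace exchange_big -sum1_card natr_sum; apply: eq_bigr => a _.
  exact: trace_choi.
have trB : trace B = #|IB|%:R.
  rewrite /trace exchange_big -sum1_card natr_sum; apply: eq_bigr => b _.
  exact: trace_choi.
have -> : trace M = #|IC|%:R * (#|J|%:R^-1 * \sum_x \sum_y A x y * B x y).
  transitivity (\sum_a \sum_b \sum_(c : IC) k a a b b).
    rewrite /trace !sum_prodT; apply: eq_bigr => a _; apply: eq_bigr => b _.
    by apply: eq_bigr => c _; rewrite /M /= eqxx mul1r.
  transitivity (#|IC|%:R * \sum_a \sum_b k a a b b).
    rewrite mulr_sumr; apply: eq_bigr => a _; rewrite mulr_sumr; apply: eq_bigr => b _.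
    by rewrite sumr_const mulr_natl.
  congr (_ * _); rewrite mulr_sumr.
  transitivity (\sum_a \sum_b \sum_x \sum_y
      #|J|%:R^-1 * (choi PhiA (a, a) x y * choi PhiB (b, b) x y)).
    apply: eq_bigr => a _; apply: eq_bigr => b _; rewrite /k /kern mulr_sumr.
    by apply: eq_bigr => x _; rewrite mulr_sumr.
  transitivity (\sum_x \sum_y \sum_a \sum_b
      #|J|%:R^-1 * (choi PhiA (a, a) x y * choi PhiB (b, b) x y)); last first.
    apply: eq_bigr => x _; rewrite mulr_sumr; apply: eq_bigr => y _.
    rewrite mulr_suml mulr_sumr; apply: eq_bigr => a _.
    by rewrite mulr_sumr mulr_sumr.
  under [RHS]eq_bigr do rewrite exchange_big /=.
  rewrite [RHS]exchange_big /=; apply: eq_bigr => a _.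
  by under [RHS]eq_bigr do rewrite exchange_big /=; rewrite [RHS]exchange_big.
rewrite normrM normr_nat -mulrA ler_wpM2l ?ler0n // normrM normfV normr_nat mulrC.
rewrite ler_wpM2r ?invr_ge0 ?ler0n // -trA -trB.
apply: le_trans (psd_hadamard_trace psdA psdB).
apply: le_trans (ler_norm_sum _ _ _) _; apply: ler_sum => x _.
exact: ler_norm_sum.
Qed.

Definition coords I J (Phi : op R I -> op R J) (u : (I * I) * (J * J)) : C :=
  choi Phi u.1 u.2.1 u.2.2.

(** The fidelity is bilinear in the two Choi matrices; these coefficients depend on [psi] only, and
    the Kronecker symbol equates the output indices of the two parties. *)
Definition fid_coef (IA IB IC J : finType) (psi : IA * IB * IC -> C)
    (w : ((IA * IA) * (J * J)) * ((IB * IB) * (J * J))) : C :=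
  #|J|%:R^-1 * (w.2.2 == w.1.2)%:R *
    ptr psi (w.1.1.1, w.2.1.1) (w.1.1.2, w.2.1.2).

Lemma fid_coords (IA IB IC J : finType) (PhiA : op R IA -> op R J) (PhiB : op R IB -> op R J)
    (psi : IA * IB * IC -> C) : op_linear PhiA -> op_linear PhiB ->
  fid PhiA PhiB psi =
  \sum_w fid_coef psi w * (coords PhiA w.1 * coords PhiB w.2).
Proof.
move=> lA lB; rewrite fid_kern // [RHS]sum_prodT [RHS]sum_prodT; apply: eq_bigr => s _.
under [RHS]eq_bigr do rewrite sum_prodT.
rewrite [RHS]exchange_big /=; apply: eq_bigr => t _.
rewrite /kern mulrAC mulr_sumr sum_prodT; apply: eq_bigr => x _.
rewrite mulr_sumr; apply: eq_bigr => y _; rewrite /fid_coef /coords /=.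
rewrite -(sum_delta (x, y) (fun z : J * J => #|J|%:R^-1 * ptr psi (s.1, t.1) (s.2, t.2) *
  (choi PhiA s x y * choi PhiB t z.1 z.2))).
by apply: eq_bigr => z _; ring.
Qed.

End LocalOperations.

(** * Interpolation at Fekete points *)

Section FeketePoints.
Variables (R : realType) (X : Type) (T : finType) (v : X -> T -> R[i]) (B : R).
Local Notation C := R[i].
Hypothesis vB : forall x t, `|v x t| <= B%:C%C.

Definition minor r (y : 'I_r -> X) (f : 'I_r -> T) : C :=
  \det (\matrix_(i, j) v (y i) (f j)).

Lemma minor_bound r y f : `|@minor r y f| <= (#|'S_r|%:R * B ^+ r)%:C%C.
Proof.
rewrite rmorphM rmorphXn rmorph_nat /minor /determinant.
apply: le_trans (ler_norm_sum _ _ _) _.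
rewrite mulr_natl -sumr_const [X in _ <= X](eq_bigl predT) //.
apply: ler_sum => s _; rewrite normrM normrX normrN1 expr1n !mul1r normr_prod.
rewrite -[X in _ ^+ X]card_ord -prodr_const; apply: ler_prod => i _.
by rewrite normr_ge0 mxE vB.
Qed.

Definition extend U r (y : 'I_r -> U) (x : U) (i : 'I_r.+1) : U :=
  if unlift ord_max i is Some k then y k else x.

Lemma extend_lift U r (y : 'I_r -> U) x k : extend y x (lift ord_max k) = y k.
Proof. by rewrite /extend liftK. Qed.

Lemma extend_max U r (y : 'I_r -> U) x : extend y x ord_max = x.
Proof. by rewrite /extend unlift_none. Qed.

(* Fekete points: choose a nonzero minor of maximal size [r] and, for its
   columns, rows nearly maximizing its modulus.  Expanding the vanishing
   [r.+1]-minors bordered by [x] and [t] along the column [t] yields the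
   interpolation coefficients. *)
Lemma fekete_points : exists (r : nat) (y : 'I_r -> X), (r <= #|T|)%N /\
  forall x, exists a : 'I_r -> C, (forall i, `|a i| <= 2) /\
    forall t, v x t = \sum_i a i * v (y i) t.
Proof.
pose Q r := `[< exists (y : 'I_r -> X) (f : 'I_r -> T), minor y f != 0 >].
have Q0 : exists r, Q r.
  exists 0%N; apply/asboolP.
  have f0 (U : Type) : 'I_0 -> U by case.
  by exists (f0 X), (f0 T); rewrite /minor det_mx00 oner_eq0.
have Qle r : Q r -> (r <= #|T|)%N.
  move=> /asboolP[y [f nz]]; rewrite -[r]card_ord; apply: leq_card (f) _.
  move=> j1 j2 fj; apply/eqP/negPn/negP => j12; move/negP: nz; apply.
  rewrite /minor -det_tr (@determinant_alternate _ _ _ j1 j2) // => i.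
  by rewrite !mxE fj.
case: (ex_maxnP Q0 Qle) => r Qr rmax; have rT := Qle _ Qr.
move/asboolP: Qr => [y0 [f y0f]].
pose N (y : 'I_r -> X) : R := complex.Re `|minor y f|.
have NE y : `|minor y f| = (N y)%:C%C by rewrite /N RRe_real // ger0_real.
have supN : has_sup (range N).
  split; first by exists (N y0), y0.
  exists (#|'S_r|%:R * B ^+ r) => _ [y _ <-]; rewrite -lecR -NE; exact: minor_bound.
have N0 : 0 < N y0 by rewrite -ltcR -NE normr_gt0.
have s0 : 0 < sup (range N).
  by apply: lt_le_trans N0 _; apply: ub_le_sup; [case: supN | exists y0].
(* On a bare type [X] the supremum need not be attained. Reaching half of it suffices and accounts
   for the bound 2 on the coefficients. *)
have [_ [y _ <-] Ny] : exists2 e, range N e & sup (range N) - sup (range N) / 2 < e.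
  by apply: sup_adherent => //; rewrite divr_gt0.
have {Ny} Nmax y' : N y' <= 2 * N y.
  have : N y' <= sup (range N) by apply: ub_le_sup; [case: supN | exists y'].
  by move: Ny; lra.
have Ny0 : 0 < N y by have := Nmax y0; lra.
have yf : minor y f != 0 by rewrite -normr_gt0 NE ltcR.
exists r, y; split => // x.
pose y' := extend y x.
pose cof (i : 'I_r.+1) : C := (-1) ^+ (i + r) * minor (fun k => y' (lift i k)) f.
have border t : \sum_i v (y' i) t * cof i = 0.
  have d0 : minor y' (extend f t) = 0.
    apply/eqP/negPn/negP => nz; have : Q r.+1 by apply/asboolP; exists y', (extend f t).
    by move=> /rmax; rewrite ltnn.
  apply: etrans d0; rewrite /minor (expand_det_col _ ord_max); apply: eq_bigr => i _.
  rewrite mxE extend_max; congr (_ * _); rewrite /cof /cofactor /=; congr (_ * _).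
  congr (\det _); apply/matrixP => k l; rewrite !mxE.
  by rewrite extend_lift.
have cofmax : cof ord_max = minor y f.
  rewrite /cof /= -signr_odd addnn odd_double expr0 mul1r; congr minor.
  by apply/funext => k; rewrite /y' extend_lift.
exists (fun i => - cof (lift ord_max i) / minor y f); split => [i|t].
  rewrite normrM normrN normfV ler_pdivrMr ?normr_gt0 //.
  rewrite /cof normrM normrX normrN1 expr1n mul1r !NE.
  by rewrite -(rmorph_nat (real_complex R) 2) -rmorphM lecR.
apply: (mulIf yf); rewrite mulr_suml; apply/eqP; rewrite -subr_eq0; apply/eqP.
apply: etrans (border t); rewrite big_ord_recr /= {2}/y' extend_max cofmax.
rewrite [RHS]addrC; congr (_ + _); rewrite -sumrN; apply: eq_bigr => i _.
have -> : widen_ord (leqnSn r) i = lift ord_max i.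
  by apply: val_inj; rewrite /= /bump leqNgt ltn_ord.
by rewrite /y' extend_lift mulrAC divfK //; ring.
Qed.

End FeketePoints.

(** * Monomials of fixed degree and their number *)

Section Monomials.
Variables (R : realType) (S : finType) (k : nat).
Local Notation C := R[i].

Definition mdeg : finType := {a : {ffun S -> 'I_k.+1} | (\sum_s a s == k)%N}.

Definition mon (c : S -> C) (a : mdeg) : C := \prod_s c s ^+ val a s.

(** The expansion of a [k]-th power runs over words [f]. Recording only the multiplicities of
    letters reduces the dimension from [|S|^k] to the number of monomials. *)
Definition mcount (f : {ffun 'I_k -> S}) : {ffun S -> 'I_k.+1} :=
  [ffun s => inord #|[pred l | f l == s]|].

Lemma mcount_deg f : (\sum_s mcount f s == k)%N.
Proof.
apply/eqP; transitivity (\sum_s #|[pred l | f l == s]|)%N.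
  apply: eq_bigr => s _; rewrite ffunE inordK // ltnS.
  by rewrite -[X in (_ <= X)%N]card_ord max_card.
under eq_bigr do rewrite -sum1_card.
rewrite -[RHS]card_ord -sum1_card (partition_big f predT) //=.
Qed.

Definition mdeg_of f : mdeg :=
  exist (fun a : {ffun S -> 'I_k.+1} => is_true (\sum_s a s == k)%N) (mcount f) (mcount_deg f).

Lemma mon_mdeg_of c f : mon c (mdeg_of f) = \prod_l c (f l).
Proof.
rewrite (partition_big f predT) //= /mon; apply: eq_bigr => s _.
rewrite /= ffunE inordK; last by rewrite ltnS -[X in (_ <= X)%N]card_ord max_card.
by rewrite -prodr_const; apply: eq_bigr => l /eqP ->.
Qed.

(** The left side is part of the generating function: summing [x^(degree)] over all exponent vectors
    gives a product of [|S|] truncated geometric series. *)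
Lemma card_mdeg (x : R) : 0 < x < 1 -> #|mdeg|%:R * x ^+ k <= (1 - x)^-1 ^+ #|S|.
Proof.
case/andP=> x0 x1; rewrite card_sig.
apply: (@le_trans _ _ (\sum_(a : {ffun S -> 'I_k.+1}) \prod_s x ^+ a s)).
  rewrite mulr_natl -sumr_const [X in _ <= X](bigID [pred a : {ffun S -> 'I_k.+1} | (\sum_s a s == k)%N]) /=.
  rewrite -[X in X <= _]addr0; apply: lerD.
    apply: ler_sum => a /eqP ak; rewrite prodrXr ak //.
  by apply: sumr_ge0 => a _; apply: prodr_ge0 => s _; rewrite exprn_ge0 // ltW.
rewrite -(bigA_distr_bigA (fun s (j : 'I_k.+1) => x ^+ j)) /=.
rewrite -prodr_const; apply: ler_prod => s _.
apply/andP; split; first by apply: sumr_ge0 => j _; rewrite exprn_ge0 // ltW.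
rewrite -[X in _ <= X]mul1r ler_pdivlMr ?subr_gt0 // mulrC.
have := subrX1 x k.+1; rewrite -opprB -[x - 1]opprB !mulNr => /oppr_inj <-.
by rewrite lerBlDr lerDl exprn_ge0 // ltW.
Qed.

End Monomials.

(** * Uniform bound over all pairs of channels *)

Section UniformBound.
Variables (R : realType) (IA IB IC J : finType).
Local Notation C := R[i].
Local Notation I := (IA * IB * IC)%type.
Local Notation SA := ((IA * IA) * (J * J))%type.
Local Notation SB := ((IB * IB) * (J * J))%type.
Hypothesis J0 : (0 < #|J|)%N.

Definition local_pair :=
  {p : (op R IA -> op R J) * (op R IB -> op R J) | channel p.1 /\ channel p.2}.

Definition fidR (L : local_pair) (psi : I -> C) : R :=
  complex.Re (fid (sval L).1 (sval L).2 psi).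

Lemma fidRE L psi : fid (sval L).1 (sval L).2 psi = (fidR L psi)%:C%C.
Proof.
rewrite /fidR RRe_real // ger0_real //; case: L => [[A B] /= [cA cB]].
by case/andP: (fid_bounds psi J0 cA cB).
Qed.

Lemma fidR_ge0 L psi : 0 <= fidR L psi.
Proof.
rewrite -lecR -fidRE; case: L => [[A B] /= [cA cB]].
by case/andP: (fid_bounds psi J0 cA cB).
Qed.

Lemma fidR_op L : exists M : op R I, [/\ psd M,
  forall v, unitv v -> qform M v <= 1, forall v, fidR L v = complex.Re (qform M v) &
  complex.Re (trace M) <= #|{: I}|%:R / #|J|%:R].
Proof.
case: L => [[A B] /= [cA cB]]; have [M [pM qM tM]] := fid_op IC J0 cA cB.
exists M; split => //.
- by move=> v uv; rewrite qM; case/andP: (fid_bounds v J0 cA cB); rewrite uv.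
- by move=> v; rewrite qM.
have h : (complex.Re (trace M))%:C%C <= `|trace M|.
  apply: le_trans (normc_ge_Re _); rewrite lecR; exact: ler_norm.
rewrite -lecR; apply: le_trans h _; apply: le_trans tM _.
by rewrite rmorphM fmorphV !rmorph_nat !card_prod !natrM [X in X / _ <= _]mulrC.
Qed.

Lemma good_fidR L : good (fidR L : cvec R I -> R).
Proof.
have [M [_ _ fM _]] := fidR_op L; have := good_re_qform M.
by congr good; apply/funext => v; rewrite fM.
Qed.

Lemma Ex_fidR_le (dsp : measure_display) (Omega : measurableType dsp)
    (P : probability Omega R) (psi : Omega -> I -> C) L k :
  haar_random P psi -> (0 < #|{: I}|)%N ->
  Ex P psi (fun v => fidR L v ^+ k) <=
    \prod_(a < k) ((#|{: I}|%:R / #|J|%:R + a%:R) / (#|{: I}|%:R + a%:R)).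
Proof.
move=> haar I0; have [M [pM M1 fM tM]] := fidR_op L.
rewrite (@eq_Ex _ _ _ _ _ _ haar _ (fun v => complex.Re (qform M v) ^+ k)).
  exact: Ex_qform_le.
by move=> v _; rewrite fM.
Qed.

(** The pairs [L] do not depend on [psi], which enters only through the coefficients [G] of a linear
    functional of [v L]; so an expectation can be taken afterwards. As fidelities are nonnegative,
    the bound on the interpolation coefficients needs no moduli of the values. *)
Lemma fidR_pow_fekete k : exists (r : nat) (L : 'I_r -> local_pair),
  (r <= #|mdeg SA k| * #|mdeg SB k|)%N /\
  forall L' psi, fidR L' psi ^+ k <= 2 * \sum_i fidR (L i) psi ^+ k.
Proof.
pose v (L : local_pair) (t : mdeg SA k * mdeg SB k) : C :=
  mon (coords (sval L).1) t.1 * mon (coords (sval L).2) t.2.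
have mon_bound (K : finType) (S := ((K * K) * (J * J))%type) (Phi : op R K -> op R J) (t : mdeg S k) :
    channel Phi -> `|mon (coords Phi) t| <= (#|K|%:R ^+ k)%:C%C.
  move=> cP; have dt : (\sum_s val t s)%N = k := eqP (valP t).
  rewrite rmorphXn rmorph_nat normr_prod -[X in _ <= _ ^+ X]dt -prodrXr.
  apply: ler_prod => s _; rewrite normr_ge0 normrX /=.
  by apply: lerXn2r; rewrite ?nnegrE ?ler0n //; exact: choi_bound.
have vB L t : `|v L t| <= (#|IA|%:R ^+ k * #|IB|%:R ^+ k)%:C%C.
  rewrite normrM rmorphM; case: L => [[A B] /= [cA cB]].
  by apply: ler_pM => //; exact: mon_bound.
have [r [L [rT HL]]] := fekete_points vB.
exists r, L; split; first by rewrite -card_prod.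
move=> L' psi; rewrite -lecR.
pose G (f : {ffun 'I_k -> SA * SB}) : C := \prod_l fid_coef psi (f l).
pose idx (f : {ffun 'I_k -> SA * SB}) : mdeg SA k * mdeg SB k :=
  (mdeg_of [ffun l => (f l).1], mdeg_of [ffun l => (f l).2]).
have powE L0 : (fidR L0 psi ^+ k)%:C%C = \sum_f G f * v L0 (idx f).
  rewrite rmorphXn /= -fidRE.
  have [[lA _ _] [lB _ _]] := svalP L0; rewrite fid_coords //.
  rewrite -[X in _ ^+ X]card_ord -prodr_const bigA_distr_bigA /=.
  apply: eq_bigr => f _; rewrite /G /v /= !mon_mdeg_of -!big_split /=.
  by apply: eq_bigr => l _; rewrite !ffunE.
have [a [a2 va]] := HL L'.
have lin : (fidR L' psi ^+ k)%:C%C = \sum_i a i * (fidR (L i) psi ^+ k)%:C%C.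
  rewrite powE; under eq_bigr do rewrite va mulr_sumr.
  rewrite exchange_big /=; apply: eq_bigr => i _; rewrite powE mulr_sumr.
  by apply: eq_bigr => f _; rewrite mulrCA.
have n0 L0 : 0 <= (fidR L0 psi ^+ k)%:C%C by rewrite lecR exprn_ge0 // fidR_ge0.
rewrite -[X in X <= _](ger0_norm (n0 L')) lin; apply: le_trans (ler_norm_sum _ _ _) _.
rewrite rmorphM rmorph_nat rmorph_sum mulr_sumr; apply: ler_sum => i _.
by rewrite normrM (ger0_norm (n0 _)) ler_wpM2r.
Qed.

Lemma Ex_indic (dsp : measure_display) (Omega : measurableType dsp)
    (P : probability Omega R) (psi : Omega -> I -> C) (S : set (cvec R I)) :
  haar_random P psi -> measurable S -> (Ex P psi \1_S)%:E = P (psi @^-1` S).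
Proof.
move=> haar mS; have mp : measurable (psi @^-1` S).
  by have := haar_measurable haar measurableT mS; rewrite setTI.
rewrite /Ex /Rintegral.
transitivity (fine (\int[P]_w (\1_(psi @^-1` S) w)%:E))%:E; first by [].
by rewrite integral_indic // setIT fineK // fin_num_measure.
Qed.

Lemma good_indic (S : set (cvec R I)) : measurable S -> good (\1_S : cvec R I -> R).
Proof.
move=> mS; split; first exact: measurable_indic.
by exists 1 => v _; rewrite indicE; case: (v \in S); rewrite ?normr1 ?normr0.
Qed.

(** Markov's inequality for the sum of [k]-th powers at the interpolation pairs. Each party
    contributes [x^(-k)] through [card_mdeg], and [q^k] is spread over the [k] moment factors. *)
Lemma prob_fidR_ge (dsp : measure_display) (Omega : measurableType dsp)
    (P : probability Omega R) (psi : Omega -> I -> C) (S : set (cvec R I)) (q x : R) k :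
  haar_random P psi -> (0 < #|{: I}|)%N -> measurable S -> 0 < q -> 0 < x < 1 ->
  (forall v, S v -> exists L, q <= fidR L v) ->
  (P (psi @^-1` S) <= (2 * x ^- (2 * k) * (1 - x)^-1 ^+ (#|{: SA}| + #|{: SB}|) *
    \prod_(a < k) ((#|{: I}|%:R / #|J|%:R + a%:R) / (q * (#|{: I}|%:R + a%:R))))%:E)%E.
Proof.
move=> haar I0 mS q0 x01 Sq; rewrite -(Ex_indic haar mS) lee_fin.
have [r [L [rT HL]]] := fidR_pow_fekete k.
have [x0 x1] := andP x01.
set pr := \prod_(a < k) ((#|{: I}|%:R / #|J|%:R + a%:R) / (#|{: I}|%:R + a%:R)) : R.
have -> : \prod_(a < k) ((#|{: I}|%:R / #|J|%:R + a%:R) / (q * (#|{: I}|%:R + a%:R)))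
    = pr / q ^+ k :> R.
  rewrite /pr -[X in _ / q ^+ X]card_ord -prodr_const -prodf_div.
  by apply: eq_bigr => a _; rewrite invfM mulrCA mulrC.
rewrite mulrA ler_pdivlMr ?exprn_gt0 //.
have gs : good (fun v : cvec R I => 2 * \sum_(i <- enum 'I_r) fidR (L i) v ^+ k).
  apply: goodM; first exact: good_cst.
  by apply: good_sum => i; apply: goodX; exact: good_fidR.
apply: (@le_trans _ _ (Ex P psi (fun v : cvec R I => 2 * \sum_(i <- enum 'I_r) fidR (L i) v ^+ k))).
  rewrite mulrC -(ExZ haar); last exact: good_indic.
  apply: (le_Ex haar) => //.
    by apply: goodM; [exact: good_cst | exact: good_indic].
  move=> v _; rewrite indicE; case: (boolP (v \in S)) => [|_].
    rewrite inE => /Sq[L' qL']; rewrite mulr1 big_enum /=.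
    apply: le_trans (HL L' v); by apply: lerXn2r; rewrite ?nnegrE ?(ltW q0) ?fidR_ge0.
  by rewrite mulr0 mulr_ge0 // sumr_ge0 // => i _; rewrite exprn_ge0 // fidR_ge0.
rewrite (ExZ haar); last by apply: good_sum => i; apply: goodX; exact: good_fidR.
rewrite (Ex_sum haar); last by move=> i; apply: goodX; exact: good_fidR.
rewrite -!mulrA ler_pM2l // mulrA.
apply: (@le_trans _ _ (r%:R * pr)).
  rewrite mulr_natl -[X in _ *+ X](card_ord r) -sumr_const big_enum /=.
  by apply: ler_sum => i _; exact: Ex_fidR_le.
apply: ler_wpM2r.
  by apply: prodr_ge0 => a _; rewrite divr_ge0 ?addr_ge0 // ?divr_ge0.
apply: (@le_trans _ _ (#|mdeg SA k|%:R * #|mdeg SB k|%:R)); first by rewrite -natrM ler_nat.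
rewrite ler_pdivlMl ?exprn_gt0 // mul2n -addnn !exprD mulrC mulrACA.
by apply: ler_pM; rewrite ?mulr_ge0 ?exprn_ge0 ?ler0n ?(ltW x0) //; exact: card_mdeg.
Qed.

End UniformBound.

(** * Measurability of the event *)

Section ComplexContinuity.
Variables (R : realType) (V : topologicalType).
Local Notation C := R[i].

Lemma continuous_bigsum (T : Type) (r : seq T) (F : T -> V -> R) :
  (forall t, continuous (F t)) -> continuous (fun x => \sum_(t <- r) F t x).
Proof.
move=> cF; elim: r => [|t r IHr].
  by under eq_fun do rewrite big_nil; move=> x; exact: cvg_cst.
under eq_fun do rewrite big_cons.
by move=> x; apply: cvgD; [exact: cF | exact: IHr].
Qed.

Definition ccont (f : V -> C) :=
  continuous (fun x => complex.Re (f x)) /\ continuous (fun x => complex.Im (f x)).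

Lemma ccont_cst z : ccont (fun=> z).
Proof. by split=> x; exact: cvg_cst. Qed.

Lemma ccontM f g : ccont f -> ccont g -> ccont (fun x => f x * g x).
Proof.
move=> [fr fi] [gr gi]; split.
  have -> : (fun x => complex.Re (f x * g x)) = (fun x =>
      complex.Re (f x) * complex.Re (g x) - complex.Im (f x) * complex.Im (g x)).
    by apply/funext => x; case: (f x) => a b; case: (g x).
  by move=> x; apply: cvgB; apply: cvgM; [exact: fr|exact: gr|exact: fi|exact: gi].
have -> : (fun x => complex.Im (f x * g x)) = (fun x =>
    complex.Re (f x) * complex.Im (g x) + complex.Im (f x) * complex.Re (g x)).
  by apply/funext => x; case: (f x) => a b; case: (g x).
by move=> x; apply: cvgD; apply: cvgM; [exact: fr|exact: gi|exact: fi|exact: gr].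
Qed.

Lemma ccont_sum (T : Type) (r : seq T) (F : T -> V -> C) :
  (forall t, ccont (F t)) -> ccont (fun x => \sum_(t <- r) F t x).
Proof.
move=> cF; split.
  under eq_fun do rewrite (raddf_sum (@complex.Re R)).
  by apply: continuous_bigsum => t; case: (cF t).
under eq_fun do rewrite (raddf_sum (@complex.Im R)).
by apply: continuous_bigsum => t; case: (cF t).
Qed.

Lemma closed_forall (U : Type) (Q : U -> V -> Prop) :
  (forall i, closed [set x | Q i x]) -> closed [set x | forall i, Q i x].
Proof.
move=> cQ; have -> : [set x | forall i, Q i x] = \bigcap_(i in setT) [set x | Q i x].
  by apply/seteqP; split => [x Qx i _ | x Qx i]; [exact: Qx | exact: (Qx i I)].
by apply: closed_bigI => i _.
Qed.

Lemma closed_ccont_ge0 f : ccont f -> closed [set x | 0 <= f x].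
Proof.
move=> [fr fi].
have -> : [set x | 0 <= f x] = [set x | complex.Im (f x) = 0] `&` [set x | 0 <= complex.Re (f x)].
  apply/seteqP; split => x /=; rewrite lecE /= => h.
    by case/andP: h => /eqP -> ->.
  by case: h => -> ->; rewrite eqxx.
apply: closedI.
  exact: ((continuous_closedP _).1 fi _ (@closed_eq R 0)).
exact: ((continuous_closedP _).1 fr _ (@closed_ge R 0)).
Qed.

Lemma closed_ccont_eq f z : ccont f -> closed [set x | f x = z].
Proof.
move=> [fr fi].
have -> : [set x | f x = z] =
    [set x | complex.Im (f x) = complex.Im z] `&` [set x | complex.Re (f x) = complex.Re z].
  apply/seteqP; split => x /=; first by move=> ->.
  by case: (f x) z => [a b] [c d] /= [-> ->].
apply: closedI.
  exact: ((continuous_closedP _).1 fi _ (@closed_eq R _)).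
exact: ((continuous_closedP _).1 fr _ (@closed_eq R _)).
Qed.

End ComplexContinuity.

Section Attained.
Variables (R : realType) (IA IB IC J : finType).
Local Notation C := R[i].
Local Notation I := (IA * IB * IC)%type.
Local Notation SA := ((IA * IA) * (J * J))%type.
Local Notation SB := ((IB * IB) * (J * J))%type.
Hypothesis J0 : (0 < #|J|)%N.
Local Notation local_pair := (local_pair R IA IB J).

Definition opof (K : finType) (c : (K * K) * (J * J) -> C) : op R K -> op R J :=
  fun X x y => \sum_(t : K * K) X t.1 t.2 * c (t, (x, y)).

Lemma opof_linear (K : finType) (c : (K * K) * (J * J) -> C) : op_linear (opof c).
Proof.
move=> a X Y i j; rewrite /opof mulr_sumr -big_split; apply: eq_bigr => t _ /=.
by rewrite mulrDl mulrA.
Qed.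

Lemma coords_opof (K : finType) (c : (K * K) * (J * J) -> C) : coords (opof c) = c.
Proof.
apply/funext => -[[k l] [x y]]; rewrite /coords /choi /opof /munit /=.
rewrite -(sum_delta (k, l) (fun t => c (t, (x, y)))); apply: eq_bigr => -[k' l'] _.
by rewrite xpair_eqE.
Qed.

Lemma opof_coords (K : finType) (Phi : op R K -> op R J) : op_linear Phi -> opof (coords Phi) = Phi.
Proof.
move=> lin; apply/funext => X; apply/funext => x; apply/funext => y.
by rewrite (op_linearE _ _ _ lin).
Qed.

(** For fixed input and test vector, positivity and trace preservation are closed conditions on the
    coordinates; linearity is automatic for [opof]. *)
Lemma closed_channel (V : topologicalType) (K : finType) (c : V -> (K * K) * (J * J) -> C) :
  (forall u, ccont (c^~ u)) -> closed [set x | channel (opof (c x))].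
Proof.
move=> cc; have -> : [set x | channel (opof (c x))] =
    [set x | completely_positive (opof (c x))] `&` [set x | trace_preserving (opof (c x))].
  apply/seteqP; split => x /=; first by case.
  by case=> h1 h2; split => //; exact: opof_linear.
have copof X i j : ccont (fun x => opof (c x) X i j).
  by apply: ccont_sum => t; apply: ccontM; [exact: ccont_cst | exact: cc].
apply: closedI.
  do 4 (apply: closed_forall => ?); apply: closed_ccont_ge0.
  do 2 (apply: ccont_sum => ?); do 2 (apply: ccontM; last exact: ccont_cst || idtac).
  all: try exact: ccont_cst.
  exact: copof.
apply: closed_forall => X; apply: closed_ccont_eq; apply: ccont_sum => i; exact: copof.
Qed.

Local Notation T := ((SA + SB) * bool)%type.
Local Notation N := #|{: T}|.

(** Both Choi matrices in one real row vector, the boolean selecting real or imaginary part;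
    compactness and the extreme value theorem then apply in a real space. *)
Definition kcoord (k : 'rV[R]_N) (t : SA + SB) : C :=
  Complex (k ord0 (enum_rank (t, true))) (k ord0 (enum_rank (t, false))).

Lemma kcoord_ccont t : ccont (kcoord^~ t).
Proof. by split; exact: coord_continuous. Qed.

Definition kpoint (z : SA + SB -> C) : 'rV[R]_N :=
  \row_i (let t := enum_val i in if t.2 then complex.Re (z t.1) else complex.Im (z t.1)).

Lemma kcoord_kpoint z : kcoord (kpoint z) = z.
Proof. by apply/funext => t; rewrite /kcoord !mxE !enum_rankK /=; case: (z t). Qed.

Definition kchannels : set 'rV[R]_N := [set k |
  channel (opof (fun u => kcoord k (inl u))) /\ channel (opof (fun u => kcoord k (inr u)))].

Lemma kchannels_compact : compact kchannels.
Proof.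
pose B : R := #|IA|%:R + #|IB|%:R.
apply: (@subclosed_compact _ _ [set k : 'rV[R]_N | forall i, `[- B, B]%classic (k ord0 i)]).
- by apply: closedI; apply: closed_channel => u; exact: kcoord_ccont.
- by apply: (@rV_compact _ _ (fun=> `[- B, B]%classic)) => i; exact: segment_compact.
move=> k [cA cB] i /=; rewrite in_itv /= -ler_norml.
have h (t : SA + SB) : `|kcoord k t| <= B%:C%C.
  rewrite rmorphD !rmorph_nat; case: t => u.
    have := choi_bound u.1 u.2.1 u.2.2 cA; rewrite -/(coords _ u) coords_opof => H.
    by apply: le_trans H _; rewrite lerDl.
  have := choi_bound u.1 u.2.1 u.2.2 cB; rewrite -/(coords _ u) coords_opof => H.
  by apply: le_trans H _; rewrite lerDr.
have hR (z : C) (b : R) : `|z| <= b%:C%C -> `|complex.Re z| <= b /\ `|complex.Im z| <= b.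
  rewrite normc_def lecR => H; split; apply: le_trans H.
    by rewrite -sqrtr_sqr ler_wsqrtr // lerDl sqr_ge0.
  by rewrite -sqrtr_sqr ler_wsqrtr // lerDr sqr_ge0.
rewrite -(enum_valK i); case: (enum_val i) => t b.
have [h1 h2] := hR _ _ (h t).
by case: b.
Qed.

(** A continuous function on the compact set [kchannels], which [L0] shows to be nonempty. *)
Lemma fidR_attained (v : I -> C) (L0 : local_pair) :
  exists L : local_pair, forall L' : local_pair, fidR L' v <= fidR L v.
Proof.
pose f (k : 'rV[R]_N) : R := complex.Re (\sum_w fid_coef v w *
  (kcoord k (inl w.1) * kcoord k (inr w.2))).
have cf : continuous f.
  suff [] : ccont (fun k : 'rV[R]_N => \sum_w fid_coef v w *
    (kcoord k (inl w.1) * kcoord k (inr w.2))) by [].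
  apply: ccont_sum => w; apply: ccontM; first exact: ccont_cst.
  by apply: ccontM; exact: kcoord_ccont.
pose kof (L : local_pair) : 'rV[R]_N := kpoint (fun t => match t with
  | inl u => coords (sval L).1 u | inr u => coords (sval L).2 u end).
have kofK L : kchannels (kof L) /\ f (kof L) = fidR L v.
  case: L => [[A B] /= [cA cB]]; have [lA _ _] := cA; have [lB _ _] := cB.
  rewrite /kchannels /f /kof /= kcoord_kpoint /fidR /= fid_coords //; split => //.
  split; [rewrite (_ : opof _ = A) // | rewrite (_ : opof _ = B) //]; exact: opof_coords.
have [k kK kmax] := EVT_max_rV (ex_intro _ _ (kofK L0).1) kchannels_compact
  (continuous_subspaceT cf).
move: kK; rewrite inE => -[cA cB].
exists (exist _ (opof (fun u => kcoord k (inl u)), opof (fun u => kcoord k (inr u))) (conj cA cB)).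
move=> L'; rewrite -(kofK L').2; apply: le_trans (kmax _ _) _.
  by rewrite inE; exact: (kofK L').1.
rewrite /f /fidR /= fid_coords; [|exact: opof_linear|exact: opof_linear].
by rewrite !coords_opof.
Qed.

(* A countable set of pairs of channels, dense for the products of coordinates
   that enter [fid]. *)
Lemma fidR_countable (L0 : local_pair) : exists D : nat -> local_pair,
  forall (v : I -> C) (a : R) (L : local_pair), a < fidR L v -> exists n, a < fidR (D n) v.
Proof.
pose z (L : local_pair) (w : SA * SB) : C := coords (sval L).1 w.1 * coords (sval L).2 w.2.
pose near (c : {ffun SA * SB -> rat * rat} * nat) (L : local_pair) := forall w,
  `|complex.Re (z L w) - ratr (c.1 w).1| < c.2.+1%:R^-1 /\
  `|complex.Im (z L w) - ratr (c.1 w).2| < c.2.+1%:R^-1.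
(* A rational point need not come from channels, so each rational cell containing a pair of channels
   contributes one of them, and an empty cell the default [L0]. *)
pose D0 c := if pselect (exists L, near c L) is left e then projT1 (cid e) else L0.
have D0P c L : near c L -> near c (D0 c).
  by rewrite /D0; case: pselect => [e _|n h]; [exact: (projT2 (cid e)) | case: n; exists L].
exists (fun n => if unpickle n is Some c then D0 c else L0) => v a L aL.
(* Two pairs in a common cell of precision [1 / (n + 1)] have fidelities at most [2 M / (n + 1)]
   apart; [n] makes this less than the gap [e]. *)
pose M := \sum_(w : SA * SB) (`|complex.Re (fid_coef v w)| + `|complex.Im (fid_coef v w)|) : R.
have M0 : 0 <= M by apply: sumr_ge0 => w _; rewrite addr_ge0.
pose e := fidR L v - a; have e0 : 0 < e by rewrite subr_gt0.
have [n nM] : exists n : nat, 2 * M / e < n.+1%:R.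
  exists (Num.bound (2 * M / e)); apply: lt_trans (archi_boundP _) _; last by rewrite ltr_nat.
  by rewrite divr_ge0 ?mulr_ge0 // ltW.
have n1 : 0 < n.+1%:R^-1 :> R by rewrite invr_gt0.
have rat_near (x : R) : exists r : rat, `|x - ratr r| < n.+1%:R^-1.
  have [|r] := @rat_in_itvoo R (x - n.+1%:R^-1) (x + n.+1%:R^-1).
    by move: (n.+1%:R^-1) n1 => u; lra.
  rewrite in_itv /= => /andP[h1 h2]; exists r; rewrite ltr_norml.
  by move: (ratr r) (n.+1%:R^-1) h1 h2 => y u h1 h2; apply/andP; split; lra.
pose c : {ffun SA * SB -> rat * rat} := [ffun w =>
  (projT1 (cid (rat_near (complex.Re (z L w)))), projT1 (cid (rat_near (complex.Im (z L w)))))].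
have nL : near (c, n) L.
  by move=> w; rewrite /= ffunE /=; split; [exact: (projT2 (cid (rat_near (complex.Re (z L w)))))
    | exact: (projT2 (cid (rat_near (complex.Im (z L w)))))].
have nD := D0P _ _ nL.
exists (pickle (c, n)); rewrite pickleK.
have fE L1 : fidR L1 v = \sum_w (complex.Re (fid_coef v w) * complex.Re (z L1 w)
    - complex.Im (fid_coef v w) * complex.Im (z L1 w)).
  rewrite /fidR; have [[lA _ _] [lB _ _]] := svalP L1; rewrite fid_coords //.
  rewrite (raddf_sum (@complex.Re R)); apply: eq_bigr => w _; rewrite -/(z L1 w).
  by case: (fid_coef v w) => p q; case: (z L1 w).
suff : fidR L v - fidR (D0 (c, n)) v <= M * (2 * n.+1%:R^-1).
  have : M * (2 * n.+1%:R^-1) < e.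
    by rewrite mulrA ltr_pdivrMr ?ltr0n // [M * 2]mulrC [e * _]mulrC -ltr_pdivrMr.
  by rewrite /e; move: (M * _) (fidR L v) => u x; lra.
rewrite !fE -sumrB /M mulr_suml; apply: ler_sum => w _.
have [h1 h2] := nL w; have [h3 h4] := nD w.
have d1 : `|complex.Re (z L w) - complex.Re (z (D0 (c, n)) w)| <= 2 * n.+1%:R^-1.
  move: (n.+1%:R^-1) h1 h3 => u; rewrite /= !ltr_norml ler_norml.
  by move=> /andP[? ?] /andP[? ?]; apply/andP; split; lra.
have d2 : `|complex.Im (z L w) - complex.Im (z (D0 (c, n)) w)| <= 2 * n.+1%:R^-1.
  move: (n.+1%:R^-1) h2 h4 => u; rewrite /= !ltr_norml ler_norml.
  by move=> /andP[? ?] /andP[? ?]; apply/andP; split; lra.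
apply: le_trans (ler_norm _) _.
rewrite (_ : _ - _ = complex.Re (fid_coef v w) * (complex.Re (z L w) - complex.Re (z (D0 (c, n)) w))
   - complex.Im (fid_coef v w) * (complex.Im (z L w) - complex.Im (z (D0 (c, n)) w))); last by ring.
rewrite mulrDl; apply: le_trans (ler_normB _ _) _; rewrite !normrM.
by apply: lerD; apply: ler_wpM2l.
Qed.

(** The countable family handles strict inequalities below each [q - 1 / (j + 1)]; that the maximum
    is attained turns their intersection over [j] back into [q <= fidR L v] for some [L]. *)
Lemma measurable_fidR_ge (q : R) :
  measurable [set v : cvec R I | exists L : local_pair, q <= fidR L v].
Proof.
have [[L0 _]|noL] := pselect (exists L : local_pair, True); last first.
  rewrite (_ : mkset _ = set0) //; apply/seteqP; split => // v [L _].
  by case: noL; exists L.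
have [D HD] := fidR_countable L0.
have -> : [set v : cvec R I | exists L : local_pair, q <= fidR L v] =
    \bigcap_j \bigcup_n [set v : cvec R I | q - j.+1%:R^-1 < fidR (D n) v].
  apply/seteqP; split => v /=.
    move=> [L qL] j _; have : q - j.+1%:R^-1 < fidR L v.
      by apply: lt_le_trans qL; rewrite ltrBlDr ltrDl invr_gt0.
    by move=> /HD[n hn]; exists n.
  move=> H; have [L HL] := fidR_attained v L0; exists L.
  rewrite leNgt; apply/negP => Lq.
  have e0 : 0 < q - fidR L v by rewrite subr_gt0.
  have [j hj] : exists j : nat, (q - fidR L v)^-1 < j.+1%:R.
    exists (Num.bound (q - fidR L v)^-1).
    by apply: lt_trans (archi_boundP _) _; rewrite ?ltr_nat // invr_ge0 ltW.
  have [n _ /= hn] := H j Logic.I; have hD := HL (D n).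
  have : j.+1%:R^-1 < q - fidR L v by rewrite invf_plt ?posrE.
  by move: (j.+1%:R^-1) (fidR L v) (fidR (D n) v) hn hD => u y z; lra.
apply: bigcapT_measurable => j; apply: bigcupT_measurable => n.
have [mf _] := good_fidR IC J0 (D n).
rewrite -[X in measurable X]setTI.
rewrite (_ : mkset _ = (fidR (D n) : cvec R I -> R) @^-1` `]q - j.+1%:R^-1, +oo[%classic).
  exact: mf.
by apply/seteqP; split => v /=; rewrite in_itv /= andbT.
Qed.

End Attained.

(** * The tail bound *)

Section TailEstimate.
Variable R : realType.

(** Since [k / 2 <= de d], the numerator [de d - (1 - q) k / 2] is at least [q de d]; so [q] cancels
    and the rate is uniform in [q]. The last factor 1/2 is [d + k / 2 <= 2 d]. *)
Lemma prod_ratio_le (q de d : R) (k : nat) : 0 < q <= 1 -> 0 < de <= q -> 0 < d ->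
  k%:R <= 2 * de * d ->
  \prod_(a < k) (((q - de) * d + a%:R) / (q * (d + a%:R))) <= expR (- (k%:R * de / 2)).
Proof.
case/andP=> q0 q1 /andP[de0 deq] d0 kd.
(* Each factor equals [1 - t a], with [t a] affine in [1 / (d + a)], as [sum_inv_arith] requires. *)
pose t (a : nat) : R := ((de + 1 - q) * d / q) * (d + a%:R)^-1 - (1 - q) / q.
apply: (@le_trans _ _ (\prod_(a < k) expR (- t a))).
  apply: ler_prod => a _.
  have da : 0 < d + a%:R by rewrite ltr_wpDr.
  rewrite divr_ge0 ?addr_ge0 ?mulr_ge0 ?subr_ge0 ?(ltW q0) ?(ltW d0) ?(ltW da) //=.
  apply: le_trans (expR_ge1Dx _); rewrite le_eqVlt; apply/orP; left; apply/eqP.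
  by rewrite /t; field; rewrite !gt_eqF.
rewrite -expR_sum ler_expR sumrN lerN2 /t sumrB -mulr_sumr sumr_const card_ord.
have hs := sum_inv_arith k d0.
have u0 : 0 < d + k%:R / 2 by rewrite ltr_wpDr // divr_ge0.
have c0 : 0 <= (de + 1 - q) * d / q.
  by rewrite divr_ge0 ?(ltW q0) // mulr_ge0 ?(ltW d0) //; lra.
apply: le_trans (lerB (ler_wpM2l c0 hs) (lexx _)).
have -> : (de + 1 - q) * d / q * (k%:R / (d + k%:R / 2)) - (1 - q) / q *+ k =
    k%:R * ((de * d - (1 - q) * (k%:R / 2)) / (q * (d + k%:R / 2))).
  by rewrite -mulr_natr; field; rewrite !gt_eqF //; lra.
rewrite -mulrA ler_wpM2l // ler_pdivlMr ?mulr_gt0 //.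
have k0 : 0 <= k%:R / 2 :> R by rewrite divr_ge0.
have kd' : k%:R / 2 <= de * d by lra.
have h1 : (1 - q) * (k%:R / 2) <= (1 - q) * (de * d) by apply: ler_wpM2l => //; lra.
have h2 : d + k%:R / 2 <= 2 * d.
  have : de * d <= 1 * d by apply: ler_wpM2r; lra.
  lra.
have h3 : de / 2 * q * (d + k%:R / 2) <= de / 2 * q * (2 * d).
  by apply: ler_wpM2l => //; rewrite mulr_ge0 ?(ltW q0) // divr_ge0 // ltW.
lra.
Qed.

Lemma tail_estimate (q de d eta : R) (N : nat) : 0 < q <= 1 -> 0 < de <= q -> 0 < d ->
  0 < eta <= 4^-1 ->
  exists (k : nat) (x : R), 0 < x < 1 /\
  2 * x ^- (2 * k) * (1 - x)^-1 ^+ N *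
    \prod_(a < k) (((q - de) * d + a%:R) / (q * (d + a%:R))) <=
  expR (2 - (1 - 4 * eta) * de ^+ 2 * d + N%:R * ln (2 / (eta * de))).
Proof.
move=> q01 de0q d0 /andP[eta0 eta1]; have [de0 deq] := andP de0q; have [q0 q1] := andP q01.
pose k := Num.truncn (2 * de * d); pose y := eta * de; pose x := expR (- y).
have /andP[k1 k2] : k%:R <= 2 * de * d < k.+1%:R.
  by apply: truncn_itv; rewrite !mulr_ge0 // ltW.
have y0 : 0 < y by rewrite mulr_gt0.
have y1 : y <= 1.
  have : eta * de <= 1 * 1 by apply: ler_pM; lra.
  by rewrite mulr1.
have x0 : 0 < x by exact: expR_gt0.
have xy : x <= (1 + y)^-1.
  by rewrite /x expRN lef_pV2 ?posrE ?expR_gt0 ?addr_gt0 //; exact: expR_ge1Dx.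
have x1 : y / 2 <= 1 - x.
  have : y / 2 <= 1 - (1 + y)^-1.
    have -> : 1 - (1 + y)^-1 = y / (1 + y) by field; rewrite gt_eqF // addr_gt0.
    by rewrite ler_wpM2l ?(ltW y0) // lef_pV2 ?posrE ?addr_gt0 //; lra.
  lra.
exists k, x; split; first by rewrite x0 /=; lra.
have e1 : 2 <= expR 1 :> R by have := @expR_ge1Dx R 1; lra.
have e2 : x ^- (2 * k) = expR (y * (2 * k%:R)).
  by rewrite /x -expRM_natr -expRN mulNr opprK natrM.
have e3 : (1 - x)^-1 ^+ N <= expR (N%:R * ln (2 / y)).
  have p : 0 < 2 / y by rewrite divr_gt0.
  rewrite mulrC expRM_natr lnK ?posrE //; apply: lerXn2r; rewrite ?nnegrE.
  - by rewrite invr_ge0; lra.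
  - exact: ltW.
  - by rewrite -[2 / y]invrK invf_div lef_pV2 ?posrE //; lra.
have e4 := prod_ratio_le q01 de0q d0 k1.
apply: (@le_trans _ _ (expR 1 * expR (y * (2 * k%:R)) * expR (N%:R * ln (2 / y)) *
    expR (- (k%:R * de / 2)))).
  have p0 : 0 <= \prod_(a < k) (((q - de) * d + a%:R) / (q * (d + a%:R))).
    apply: prodr_ge0 => a _; apply: divr_ge0; first by rewrite addr_ge0 // mulr_ge0 ?(ltW d0) //; lra.
    by rewrite mulr_ge0 ?(ltW q0) // addr_ge0 // ltW.
  apply: ler_pM => //; first by rewrite !mulr_ge0 ?e2 ?expR_ge0 // exprn_ge0 // invr_ge0; lra.
  apply: ler_pM => //; first by rewrite !mulr_ge0 ?e2 ?expR_ge0.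
    by rewrite exprn_ge0 // invr_ge0; lra.
  by rewrite e2 ler_wpM2r // expR_ge0.
rewrite -!expRD ler_expR /y; set L := N%:R * ln _.
have kk : 2 * de * d - 1 <= k%:R by move: k2; rewrite -natr1; lra.
have := @ler_wpM2l _ ((2^-1 - 2 * eta) * de) _ _ _ kk.
have w0 : 0 <= (2^-1 - 2 * eta) * de by rewrite mulr_ge0 ?(ltW de0) //; lra.
move=> /(_ w0) h.
have h2 : (2^-1 - 2 * eta) * de <= 1.
  have : (2^-1 - 2 * eta) * de <= 1 * 1 by apply: ler_pM => //; lra.
  lra.
lra.
Qed.

End TailEstimate.

(** * Qubit systems and the distillation event *)

Section Qubits.
Variable R : realType.
Local Notation C := R[i].

Lemma card_qubits n : #|qubits n| = (2 ^ n)%N.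
Proof. by rewrite /qubits card_ffun card_bool card_ord. Qed.

Lemma EPRmE m (p : qubits m * qubits m) : EPRm R p =
  (p.1 == p.2)%:R * (real_complex R (Num.sqrt 2)) ^- m.
Proof.
rewrite /EPRm big_split /= prodr_const card_ord exprVn; congr (_ * _).
have [->|ne] := eqVneq p.1 p.2; first by apply: big1 => k _; rewrite eqxx.
have [k kne] : exists k, p.1 k != p.2 k.
  apply/existsP; apply: contraNT ne => /existsPn h; apply/eqP/ffunP => k.
  by apply/eqP; rewrite -[_ == _]negbK h.
by rewrite (bigD1 k) //= (negPf kne) mul0r.
Qed.

Lemma trace_EPR m (Y : op R (qubits m * qubits m)%type) :
  trace (opmul Y (@PiEPR R m)) = epr Y.
Proof.
pose s : C := (real_complex R (Num.sqrt 2)) ^- m.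
have sc : s^* = s.
  by rewrite /s -exprVn -fmorphV -rmorphXn; exact: conjc_real.
have ss : s * s = #|qubits m|%:R^-1.
  rewrite /s -invfM -exprMn -rmorphM -expr2 sqr_sqrtr // card_qubits natrX.
  by rewrite rmorph_nat.
rewrite /trace /opmul /PiEPR /epr -ss mulr_sumr sum_prodT; apply: eq_bigr => x _.
transitivity (\sum_x' (x' == x)%:R * \sum_(k : qubits m * qubits m)
  Y (x, x') k * (EPRm R k * s^*)).
  apply: eq_bigr => x' _; rewrite mulr_sumr; apply: eq_bigr => k _.
  rewrite [EPRm R (x, x')]EPRmE /= [((_ == _)%:R * _)^*]rmorphM rmorph_nat -/s eq_sym /=; ring.
rewrite sum_delta mulr_sumr sum_prodT; apply: eq_bigr => y _.
rewrite -(sum_delta y (fun y' => s * s * Y (x, x) (y, y'))); apply: eq_bigr => y' _.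
by rewrite EPRmE -/s sc /= eq_sym; ring.
Qed.

Lemma LO_achievableE nA nB nC (v : qubits nA * qubits nB * qubits nC -> C) h m :
  LO_achievable (rhoAB v) h m <->
  exists L : local_pair R (qubits nA) (qubits nB) (qubits m), h ^+ 2 <= fidR L v.
Proof.
have J0 : (0 < #|qubits m|)%N by rewrite card_qubits expn_gt0.
split.
  move=> [A [B [cA cB]]]; rewrite trace_EPR => H.
  exists (exist _ (A, B) (conj cA cB)); rewrite -lecR -(fidRE J0); exact: H.
move=> [[[A B] /= [cA cB]] H]; exists A, B; split => //.
rewrite trace_EPR; rewrite -lecR in H.
by apply: le_trans H _; rewrite -(fidRE J0).
Qed.

(** Both parties discard the surplus output qubits, and [epr_marg] shows that no fidelity is lost.
    This identifies the event with achievability of exactly [m], and it permits fewer pairs in the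
    estimate. *)
Lemma LO_achievable_leq nA nB nC (v : qubits nA * qubits nB * qubits nC -> C) h m m' :
  (m <= m')%N -> LO_achievable (rhoAB v) h m' -> LO_achievable (rhoAB v) h m.
Proof.
move=> /subnKC <-; move: (m' - m)%N => r [A [B [cA cB]]]; rewrite trace_EPR => H.
pose e (p : qubits m * qubits r) : qubits (m + r) :=
  [ffun k : 'I_(m + r) => match fintype.split k with inl i => p.1 i | inr j => p.2 j end : bool].
pose e' (x : qubits (m + r)) : qubits m * qubits r :=
  ([ffun i : 'I_m => x (lshift r i)], [ffun j : 'I_r => x (rshift m j)]).
have be : bijective e.
  exists e' => [[z a]|x].
    rewrite /e' /e; congr pair; apply/ffunP => i; rewrite !ffunE.
      by rewrite (unsplitK (inl i)).
    by rewrite (unsplitK (inr i)).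
  apply/ffunP => k; rewrite /e /e' ffunE -[in RHS](splitK k).
  by case: (fintype.split k) => i /=; rewrite ffunE.
exists (marg e A), (marg e B); split; try exact: channel_marg.
rewrite trace_EPR; apply: le_trans H _.
apply: (epr_marg be); rewrite ?card_qubits ?expn_gt0 //; exact: psd_ptr.
Qed.

Lemma LO_distillable_geE nA nB nC (v : qubits nA * qubits nB * qubits nC -> C) h m :
  LO_distillable_ge (rhoAB v) h m <-> LO_achievable (rhoAB v) h m.
Proof.
split=> [[m' [mm']]|H]; last by exists m.
exact: LO_achievable_leq.
Qed.

(** Keeping [m0 <= m] pairs lowers the entropy factor to [2^(2 m0)] at the price of the smaller gap
    [h^2 - 2^-m0]. *)
Lemma prob_LO_achievable nA nB nC (dsp : measure_display) (Omega : measurableType dsp)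
    (P : probability Omega R) (psi : Omega -> qubits nA * qubits nB * qubits nC -> C)
    (m0 m : nat) (h eta : R) :
  haar_random P psi -> (m0 <= m)%N -> 0 < h <= 1 -> 0 < h ^+ 2 - 2 ^- m0 ->
  0 < eta <= 4^-1 ->
  (P [set w | LO_distillable_ge (rhoAB (psi w)) h m] <=
   (expR (2 - (1 - 4 * eta) * (h ^+ 2 - 2 ^- m0) ^+ 2 * 2 ^+ (nA + nB + nC)
     + 2 ^+ (2 * m0) * (2 ^+ (2 * nA) + 2 ^+ (2 * nB))
         * ln (2 / (eta * (h ^+ 2 - 2 ^- m0)))))%:E)%E.
Proof.
move=> haar mm /andP[h0 h1]; set de := h ^+ 2 - 2 ^- m0 => de0 eta01.
have J0 k : (0 < #|qubits k|)%N by rewrite card_qubits expn_gt0.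
pose S k : set (cvec R (qubits nA * qubits nB * qubits nC)%type) :=
  [set v | exists L : local_pair R (qubits nA) (qubits nB) (qubits k), h ^+ 2 <= fidR L v].
have mS k : measurable (S k) by exact: measurable_fidR_ge.
have mpS k : measurable (psi @^-1` S k).
  by have := haar_measurable haar measurableT (mS k); rewrite setTI.
have evE : [set w | LO_distillable_ge (rhoAB (psi w)) h m] = psi @^-1` S m.
  by apply/seteqP; split => w; rewrite /= LO_distillable_geE LO_achievableE.
have SS : psi @^-1` S m `<=` psi @^-1` S m0.
  by move=> w; rewrite /S /= -!LO_achievableE; exact: LO_achievable_leq.
rewrite evE; apply: (@le_trans _ _ (P (psi @^-1` S m0))).
  by apply: le_measure => //; rewrite inE.
have q01 : 0 < h ^+ 2 <= 1 by rewrite exprn_gt0 //= expr_le1 // ltW.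
have deq : 0 < de <= h ^+ 2 by rewrite de0 /= lerBlDr lerDl invr_ge0 exprn_ge0.
have cI : #|{: qubits nA * qubits nB * qubits nC}| = (2 ^ (nA + nB + nC))%N.
  by rewrite !card_prod !card_qubits !expnD.
have d0 : 0 < 2 ^+ (nA + nB + nC) :> R by rewrite exprn_gt0.
pose N := (2 ^ (2 * m0) * (2 ^ (2 * nA) + 2 ^ (2 * nB)))%N.
have [k [x [x01 hk]]] := tail_estimate N q01 deq d0 eta01.
have q0 : 0 < h ^+ 2 by case/andP: q01.
have I0 : (0 < #|{: qubits nA * qubits nB * qubits nC}|)%N by rewrite cI expn_gt0.
have := @prob_fidR_ge _ _ _ _ _ (J0 m0) _ _ P psi (S m0) (h ^+ 2) x k haar I0 (mS m0) q0 x01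
  (fun v H => H).
move=> H; apply: le_trans H _; rewrite lee_fin.
have NE : N%:R = 2 ^+ (2 * m0) * (2 ^+ (2 * nA) + 2 ^+ (2 * nB)) :> R.
  by rewrite /N natrM natrD !natrX.
rewrite -NE; apply: le_trans hk; rewrite le_eqVlt; apply/orP; left; apply/eqP.
have -> : (#|{: (qubits nA * qubits nA) * (qubits m0 * qubits m0)}| +
  #|{: (qubits nB * qubits nB) * (qubits m0 * qubits m0)}| = N)%N.
  by rewrite !card_prod !card_qubits /N !mul2n -!addnn !expnD; ring.
congr (_ * _); apply: eq_bigr => a _; rewrite cI card_qubits !natrX.
by congr ((_ + _) / _); rewrite /de subKr mulrC.
Qed.

End Qubits.

Theorem theorem2 (R : realType) (c : R) :
  0 < c < 1 ->
  exists K : R, 0 < K /\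
  forall (nA nB nC m : nat) (h : R),
    (0 < nA)%N -> (0 < nB)%N -> (0 < nC)%N ->
    0 < h <= 1 ->
    0 < h ^+ 2 - 2 ^- m ->
    forall (dsp : measure_display) (Omega : measurableType dsp)
           (P : probability Omega R)
           (psi : Omega -> (qubits nA * qubits nB * qubits nC)%type -> R[i]),
      haar_random P psi ->
      (P [set w | LO_distillable_ge (rhoAB (psi w)) h m]
       <= (expR (- c * (h ^+ 2 - 2 ^- m) ^+ 2 * 2 ^+ (nA + nB + nC)
                 + K * (2 ^+ (2 * m) * (2 ^+ (2 * nA) + 2 ^+ (2 * nB)))
                     * ln ((h ^+ 2 - 2 ^- m)^-1)))%:E)%E.
Proof.
(* Then [c = 1 - 8 eta], while the estimate gives the rate [1 - 4 eta]: the remaining [4 eta] pays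
   for replacing [de] by a smaller gap. *)
case/andP=> c0 c1; pose eta : R := (1 - c) / 8.
have eta0 : 0 < eta by rewrite divr_gt0 // subr_gt0.
have eta1 : eta <= 8^-1 by rewrite /eta; lra.
have cE : c = 1 - 8 * eta by rewrite /eta; lra.
have eta01 : 0 < eta <= 4^-1 by rewrite eta0 /=; lra.
have [M M1 Meta] : exists2 M : nat, (0 < M)%N & 2 ^- M <= eta.
  exists (Num.bound eta^-1).+1 => //.
  rewrite invf_ple ?posrE ?exprn_gt0 //.
  apply: le_trans (ltW (archi_boundP _)) _; first by rewrite invr_ge0 ltW.
  by rewrite -natrX ler_nat ltnW // ltnW // ltn_expl.
have L0 : 0 <= ln (8 / eta) by rewrite ln_ge0 // ler_pdivlMr // mul1r; lra.
(* The 1 carries the term [ln de^-1] itself. The factor [4^M] compensates [ln de^-1 >= 2^-M] when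
   [de] is away from 1, and is the cost of the [M] kept pairs otherwise. *)
pose K : R := 1 + 4 ^+ M * (2 + ln (8 / eta)).
have K0 : 0 < K.
  by rewrite ltr_pwDl // mulr_ge0 ?exprn_ge0 // addr_ge0.
exists K; split => // nA nB nC m h nA0 nB0 nC0 h01 de0 dsp Omega P psi haar.
have h21 : h ^+ 2 <= 1 by case/andP: h01 => ? ?; rewrite expr_le1 // ltW.
set de := h ^+ 2 - 2 ^- m in de0 *.
have pm (k : nat) : 0 < 2 ^- k :> R by rewrite invr_gt0 exprn_gt0.
have de1 : de < 1 by have := pm m; rewrite /de; lra.
have l1 : 1 - de <= ln de^-1.
  rewrite lnV ?posrE // lerNr opprB; have := @le_ln1Dx R (de - 1).
  by rewrite [1 + _]addrC subrK; apply; lra.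
have l0 : 0 < ln de^-1 by apply: lt_le_trans l1; rewrite subr_gt0.
pose d : R := 2 ^+ (nA + nB + nC); have d0 : 0 < d by rewrite exprn_gt0.
pose N : R := 2 ^+ (2 * nA) + 2 ^+ (2 * nB).
have N1 : 1 <= N.
  have a1 : 1 <= 2 ^+ (2 * nA) :> R by rewrite exprn_ege1 // ler1n.
  by have := @exprn_ge0 R (2 * nB) 2 (ler0n _ _); rewrite /N; lra.
have e4 (k : nat) : 2 ^+ (2 * k) = 4 ^+ k :> R by rewrite exprM; congr (_ ^+ _); rewrite expr2; lra.
rewrite -/d -/N e4.
have fin (m0 : nat) (x : R) : (m0 <= m)%N ->
    de ^+ 2 * (1 - 8 * eta) <= (1 - 4 * eta) * (h ^+ 2 - 2 ^- m0) ^+ 2 ->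
    0 < h ^+ 2 - 2 ^- m0 ->
    2 + 4 ^+ m0 * N * ln (2 / (eta * (h ^+ 2 - 2 ^- m0))) <= K * (4 ^+ m * N) * ln de^-1 ->
  (P [set w | LO_distillable_ge (rhoAB (psi w)) h m] <=
    (expR (- c * de ^+ 2 * d + K * (4 ^+ m * N) * ln de^-1))%:E)%E.
  move=> mm hd dm0 hK; apply: le_trans (prob_LO_achievable haar mm h01 dm0 eta01) _.
  rewrite lee_fin ler_expR -/d -/N e4 cE.
  have := ler_wpM2r (ltW d0) hd; lra.
(* Away from 1 all [m] pairs are kept: [ln de^-1 >= 1 - de >= 2^-M] absorbs the constants. *)
have [h12|h12] := lerP (2 ^- M) (1 - de).
  apply: (fin m 0) => //; rewrite -/de.
    by have := mulr_ge0 (ltW eta0) (sqr_ge0 de); lra.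
  have -> : ln (2 / (eta * de)) = ln (2 / eta) + ln de^-1.
    have p1 : 0 < 2 / eta by exact: divr_gt0.
    have p2 : 0 < de^-1 by rewrite invr_gt0.
    by rewrite -lnM ?posrE //; congr (ln _); field; rewrite !gt_eqF.
  have L2 : ln (2 / eta) <= ln (8 / eta).
    have p1 : 0 < 2 / eta by exact: divr_gt0.
    have p2 : 0 < 8 / eta by exact: divr_gt0.
    rewrite ler_ln ?posrE //; apply: ler_wpM2r; last by lra.
    by rewrite invr_ge0 ltW.
  pose F : R := 4 ^+ m * N.
  have F1 : 1 <= F by rewrite -[1]mulr1 ler_pM // exprn_ege1 //; lra.
  have Ml : 1 <= 4 ^+ M * ln de^-1.
    have : 2 ^+ M * 2 ^- M <= 4 ^+ M * ln de^-1.
      apply: ler_pM; rewrite ?exprn_ge0 ?(ltW (pm _)) //; last exact: le_trans h12 l1.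
      by apply: lerXn2r; rewrite ?nnegrE //; lra.
    by rewrite mulfV // gt_eqF // exprn_gt0.
  rewrite -/F /K.
  have t1 : F * (2 + ln (8 / eta)) <= F * (2 + ln (8 / eta)) * (4 ^+ M * ln de^-1).
    by rewrite ler_peMr // mulr_ge0 ?addr_ge0 //; lra.
  have t2 : F * ln (2 / eta) <= F * ln (8 / eta) by apply: ler_wpM2l => //; lra.
  lra.
(* Near 1 only [M] pairs are kept. This is possible because [2^-m <= 1 - de < 2^-M], and it lowers
   the gap by at most [eta]. *)
have Mm : (M < m)%N.
  rewrite ltnNge; apply/negP => mM.
  have : 2 ^- M <= 2 ^- m :> R.
    by rewrite lef_pV2 ?posrE ?exprn_gt0 // ler_weXn2l // ler1n.
  by move: h12; rewrite /de; lra.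
have dd : de - eta <= h ^+ 2 - 2 ^- M by have := pm m; rewrite /de; lra.
have de8 : 7 / 8 <= de by lra.
apply: (fin M 0) => //; first exact: ltnW.
- have u0 : 0 <= de * (1 - 2 * eta) by rewrite mulr_ge0 //; lra.
  have u1 : de * (1 - 2 * eta) <= h ^+ 2 - 2 ^- M.
    have : eta * 1 <= eta * (2 * de) by apply: ler_wpM2l; lra.
    lra.
  have u2 : (de * (1 - 2 * eta)) ^+ 2 <= (h ^+ 2 - 2 ^- M) ^+ 2.
    by apply: lerXn2r; rewrite ?nnegrE //; lra.
  have e14 : 0 <= 1 - 4 * eta by lra.
  apply: le_trans (ler_wpM2l e14 u2).
  (* The excess of [(1 - 4 eta) (1 - 2 eta)^2] over [1 - 8 eta]. *)
  have w0 : 0 <= 16 * eta ^+ 2 + 4 * ((1 - 4 * eta) * eta ^+ 2).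
    have := sqr_ge0 eta; have := mulr_ge0 e14 (sqr_ge0 eta); lra.
  have := mulr_ge0 (sqr_ge0 de) w0; lra.
- lra.
have L2 : ln (2 / (eta * (h ^+ 2 - 2 ^- M))) <= ln (8 / eta).
  set de' := h ^+ 2 - 2 ^- M in dd *; have d4 : 4^-1 <= de' by lra.
  have p3 : 0 < eta * de' by apply: mulr_gt0 => //; lra.
  have p1 : 0 < 2 / (eta * de') by exact: divr_gt0.
  have p2 : 0 < 8 / eta by exact: divr_gt0.
  rewrite ler_ln ?posrE // ler_pdivrMr // mulrA divfK ?gt_eqF //; lra.
(* Here [ln de^-1 >= 1 - de >= 2^-m], so the factor [4^m] in the error term outweighs the smallness
   of the logarithm. *)
have Ml : 1 <= 4 ^+ m * ln de^-1.
  have : 2 ^+ m * 2 ^- m <= 4 ^+ m * ln de^-1.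
    apply: ler_pM; rewrite ?exprn_ge0 ?(ltW (pm _)) //.
      by apply: lerXn2r; rewrite ?nnegrE //; lra.
    by apply: le_trans l1; rewrite /de; lra.
  by rewrite mulfV // gt_eqF // exprn_gt0.
have M4 : 1 <= 4 ^+ M :> R by rewrite exprn_ege1 //; lra.
have F0 : 1 <= 4 ^+ M * N by have := ler_pM ler01 ler01 M4 N1; rewrite mulr1.
have t1 : 4 ^+ M * N * ln (2 / (eta * (h ^+ 2 - 2 ^- M))) <= 4 ^+ M * N * ln (8 / eta).
  by apply: ler_wpM2l => //; lra.
have t2 : K * N <= K * N * (4 ^+ m * ln de^-1).
  by rewrite ler_peMr // mulr_ge0 ?(ltW K0) //; lra.
move: t2; rewrite /K; lra.
Qed.
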